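(* $\mathsf{RG}^2_{8,4}$ implies $\mathsf{SRT}^2_2$ over $\mathsf{RCA}_0$.
   Context: A graph $(G,E)$ is a Rado graph if for every two disjoint finite sets of vertices $F_0,F_1$ there is a vertex adjacent to all of $F_0$ and to none of $F_1$. Fix a computable Rado graph $\mathcal R$. $\mathsf{RG}^2_{k,\ell}$: for every coloring $f:[\mathcal R]^2\to k$ of the $2$-element vertex sets of $\mathcal R$ there is an induced subgraph $\mathcal R'$ of $\mathcal R$ isomorphic to $\mathcal R$ with $|f([\mathcal R']^2)|\le\ell$. A coloring $f:[\omega]^2\to2$ is stable if for every $x$, $\lim_y f(x,y)$ exists. $\mathsf{SRT}^2_2$: every stable $f:[\omega]^2\to2$ has an infinite set $H$ with $f$ constant on $[H]^2$. *)

(* Defs.v *)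
(* Reverse mathematics over RCA_0, formalized semantically:
   "RCA_0 + A |- B" is rendered (via Goedel completeness) as
   "every L_2-structure satisfying the axioms of RCA_0 and A satisfies B". *)
From Stdlib Require Import List.
Import ListNotations.

Record L2struct := {
  N : Type;
  S : Type;
  zero : N;
  one : N;
  add : N -> N -> N;
  mul : N -> N -> N;
  lt : N -> N -> Prop;
  mem : N -> S -> Prop
}.

(** * Syntax of arithmetical L_2 formulas (de Bruijn number variables,
      set variables are parameters indexed by nat) *)
Inductive term : Type :=
| tvar : nat -> term
| tzero : term
| tone : term
| tadd : term -> term -> term
| tmul : term -> term -> term.

Inductive form : Type :=
| feq : term -> term -> form
| flt : term -> term -> form
| fmem : term -> nat -> form
| fnot : form -> form
| fand : form -> form -> form
| for_ : form -> form -> form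
| fimp : form -> form -> form
| fall : form -> form
| fex : form -> form
| fball : term -> form -> form          (* forall n < t (t in outer scope) *)
| fbex : term -> form -> form.          (* exists n < t (t in outer scope) *)

Definition scons {A : Type} (a : A) (e : nat -> A) : nat -> A :=
  fun i => match i with 0 => a | Datatypes.S j => e j end.

Section Sem.
Variable M : L2struct.

Fixpoint teval (e : nat -> N M) (t : term) : N M :=
  match t with
  | tvar i => e i
  | tzero => zero M
  | tone => one M
  | tadd t1 t2 => add M (teval e t1) (teval e t2)
  | tmul t1 t2 => mul M (teval e t1) (teval e t2)
  end.

Fixpoint feval (e : nat -> N M) (s : nat -> S M) (f : form) : Prop :=
  match f with
  | feq t u => teval e t = teval e u
  | flt t u => lt M (teval e t) (teval e u)
  | fmem t X => mem M (teval e t) (s X)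
  | fnot g => ~ feval e s g
  | fand g h => feval e s g /\ feval e s h
  | for_ g h => feval e s g \/ feval e s h
  | fimp g h => feval e s g -> feval e s h
  | fall g => forall a, feval (scons a e) s g
  | fex g => exists a, feval (scons a e) s g
  | fball t g => forall a, lt M a (teval e t) -> feval (scons a e) s g
  | fbex t g => exists a, lt M a (teval e t) /\ feval (scons a e) s g
  end.
End Sem.

Fixpoint bounded (f : form) : Prop :=
  match f with
  | feq _ _ | flt _ _ | fmem _ _ => True
  | fnot g => bounded g
  | fand g h | for_ g h | fimp g h => bounded g /\ bounded h
  | fall _ | fex _ => False
  | fball _ g | fbex _ g => bounded g
  end.

Definition sigma01 (f : form) : Prop := exists g, bounded g /\ f = fex g.
Definition pi01 (f : form) : Prop := exists g, bounded g /\ f = fall g.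

(** * The axioms of RCA_0 (Simpson, SOSOA I.2.4, II.1.1) *)
Definition basic_axioms (M : L2struct) : Prop :=
  (forall n : N M, add M n (one M) <> zero M) /\
  (forall m n : N M, add M m (one M) = add M n (one M) -> m = n) /\
  (forall m : N M, ~ lt M m (zero M)) /\
  (forall m n : N M, lt M m (add M n (one M)) <-> (lt M m n \/ m = n)) /\
  (forall m : N M, add M m (zero M) = m) /\
  (forall m n : N M, add M m (add M n (one M)) = add M (add M m n) (one M)) /\
  (forall m : N M, mul M m (zero M) = zero M) /\
  (forall m n : N M, mul M m (add M n (one M)) = add M (mul M m n) m).

(* Sigma^0_1 induction; variable 0 is the induction variable, all other
   free number and set variables are parameters. *)
Definition sigma01_induction (M : L2struct) : Prop :=
  forall (phi : form) (e : nat -> N M) (s : nat -> S M),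
    sigma01 phi ->
    feval M (scons (zero M) e) s phi ->
    (forall n, feval M (scons n e) s phi -> feval M (scons (add M n (one M)) e) s phi) ->
    forall n, feval M (scons n e) s phi.

Definition delta01_comprehension (M : L2struct) : Prop :=
  forall (phi psi : form) (e : nat -> N M) (s : nat -> S M),
    sigma01 phi -> pi01 psi ->
    (forall n, feval M (scons n e) s phi <-> feval M (scons n e) s psi) ->
    exists X : S M, forall n, mem M n X <-> feval M (scons n e) s phi.

Definition RCA0 (M : L2struct) : Prop :=
  basic_axioms M /\ sigma01_induction M /\ delta01_comprehension M.

Section Internal.
Variable M : L2struct.

Fixpoint numeral (k : nat) : N M :=
  match k with
  | 0 => zero M
  | Datatypes.S j => add M (numeral j) (one M)
  end.

(* Simpson's pairing function (i,j) = (i+j)^2 + i *)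
Definition pair (i j : N M) : N M := add M (mul M (add M i j) (add M i j)) i.

(* finite = bounded (equivalent to coded finite in RCA_0) *)
Definition finite_set (X : S M) : Prop := exists b, forall m, mem M m X -> lt M m b.

Definition infinite_set (X : S M) : Prop := forall n, exists m, lt M n m /\ mem M m X.

(* A coloring f : [N]^2 -> k, coded by the set F of pairs ((x,y),c), x<y. *)
Definition fval (F : S M) (x y c : N M) : Prop := mem M (pair (pair x y) c) F.

Definition coloring (k : nat) (F : S M) : Prop :=
  forall x y, lt M x y ->
    exists c, lt M c (numeral k) /\ fval F x y c /\
              (forall c', fval F x y c' -> c' = c).

(* Graphs with vertex set N, edge set coded by E *)
Definition adj (E : S M) (x y : N M) : Prop := mem M (pair x y) E.

Definition is_graph (E : S M) : Prop :=
  (forall x, ~ adj E x x) /\ (forall x y, adj E x y -> adj E y x).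

Definition is_rado_graph (E : S M) : Prop :=
  is_graph E /\
  forall F0 F1 : S M, finite_set F0 -> finite_set F1 ->
    (forall x, mem M x F0 -> ~ mem M x F1) ->
    exists v, (forall u, mem M u F0 -> adj E v u) /\
              (forall u, mem M u F1 -> ~ adj E v u).

Definition iso_onto_induced (E V' H : S M) : Prop :=
  (forall v, exists w, mem M (pair v w) H /\ forall w', mem M (pair v w') H -> w' = w) /\
  (forall v w, mem M (pair v w) H -> mem M w V') /\
  (forall v v' w, mem M (pair v w) H -> mem M (pair v' w) H -> v = v') /\
  (forall w, mem M w V' -> exists v, mem M (pair v w) H) /\
  (forall v v' w w', mem M (pair v w) H -> mem M (pair v' w') H ->
      (adj E v v' <-> adj E w w')).

Definition RG2 (E : S M) (k l : nat) : Prop :=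
  forall F, coloring k F ->
    exists V' : S M,
      (exists H : S M, iso_onto_induced E V' H) /\
      exists cs : list (N M), length cs <= l /\
        forall x y, mem M x V' -> mem M y V' -> lt M x y ->
          exists c, In c cs /\ fval F x y c.

Definition stable (F : S M) : Prop :=
  forall x, exists c n, forall y, lt M n y -> lt M x y -> fval F x y c.

Definition SRT22 : Prop :=
  forall F, coloring 2 F -> stable F ->
    exists H : S M, infinite_set H /\
      exists c, forall x y, mem M x H -> mem M y H -> lt M x y -> fval F x y c.
End Internal.

(* Main.v *)
(** Call [x] lexicographically below [y] if, at the first vertex distinguishing them, it is [y] that
    has the edge, and color a pair [x < y] by its adjacency, its lexicographic orientation and [f x y].
    Every copy of the Rado graph realizes the four pairs (adjacency, orientation), so on a copy with
    at most four colors [f] is a function of that pair. If for some value of the adjacency [f] ignores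
    the orientation, an infinite clique or anticlique is homogeneous. If [f] is the exclusive or of
    both, stability is contradicted by prescribing adjacencies to two vertices. There remains the
    case where [f] is the orientation; then each vertex of the copy has almost all others on one
    side. Two vertices of the copy split it into infinite pieces, three of which contain an infinite
    set of vertices with the same initial adjacencies, and the lexicographically middle one has
    infinitely many vertices on both sides. The infinite pigeonhole principle used here is not
    available in RCA_0; it is itself obtained from the first part of the argument, applied to the
    stable coloring "same class" of a partition into finite classes.

    Finite sets and sequences of the model are coded by vertices of the Rado graph. *)

Require Import Defs.
From Stdlib Require Import Arith List Classical FunctionalExtensionality FinFun Lia.

Local Notation sc := Datatypes.S.

(** * Definable predicates *)

Fixpoint rent (r : nat -> nat) (t : term) : term :=
  match t with
  | tvar i => tvar (r i)
  | tzero => tzero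
  | tone => tone
  | tadd t u => tadd (rent r t) (rent r u)
  | tmul t u => tmul (rent r t) (rent r u)
  end.

Definition up (r : nat -> nat) : nat -> nat := scons 0 (fun i => sc (r i)).

Fixpoint renf (r q : nat -> nat) (f : form) : form :=
  match f with
  | feq t u => feq (rent r t) (rent r u)
  | flt t u => flt (rent r t) (rent r u)
  | fmem t X => fmem (rent r t) (q X)
  | fnot g => fnot (renf r q g)
  | fand g h => fand (renf r q g) (renf r q h)
  | for_ g h => for_ (renf r q g) (renf r q h)
  | fimp g h => fimp (renf r q g) (renf r q h)
  | fall g => fall (renf (up r) q g)
  | fex g => fex (renf (up r) q g)
  | fball t g => fball (rent r t) (renf (up r) q g)
  | fbex t g => fbex (rent r t) (renf (up r) q g)
  end.

Definition tl {A : Type} (e : nat -> A) : nat -> A := fun i => e (sc i).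
Definition ev (i : nat) := 2 * i.
Definition od (i : nat) := sc (2 * i).
(** Interleaving lets arguments and parameters, or two parameter lists, share one environment. *)
Definition mix {A : Type} (e p : nat -> A) (i : nat) : A :=
  if Nat.even i then e (Nat.div2 i) else p (Nat.div2 i).

Lemma mix_ev A (e p : nat -> A) i : mix e p (ev i) = e i.
Proof.
  unfold mix, ev. rewrite Nat.even_mul. cbn [Nat.even orb].
  now rewrite Nat.div2_double.
Qed.

Lemma mix_od A (e p : nat -> A) i : mix e p (od i) = p i.
Proof.
  unfold mix, od. rewrite Nat.even_succ, Nat.odd_mul. cbn [Nat.odd Nat.even negb andb].
  now rewrite Nat.div2_succ_double.
Qed.

Lemma comp_mix A B (h : A -> B) e p : (fun i => h (mix e p i)) = mix (fun i => h (e i)) (fun i => h (p i)).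
Proof. extensionality i. unfold mix. now destruct (Nat.even i). Qed.

Lemma mix_comp_ev A (e p : nat -> A) : (fun i => mix e p (ev i)) = e.
Proof. extensionality i. apply mix_ev. Qed.

Lemma mix_comp_od A (e p : nat -> A) : (fun i => mix e p (od i)) = p.
Proof. extensionality i. apply mix_od. Qed.

(* A parameter list mixing [p] and [q] is read back by these two renamings. *)
Lemma mix_left A (e p q : nat -> A) :
  (fun i => mix e (mix p q) (mix ev (fun j => od (ev j)) i)) = mix e p.
Proof.
  rewrite (comp_mix _ _ (mix e (mix p q))), mix_comp_ev.
  f_equal. extensionality i. now rewrite mix_od, mix_ev.
Qed.

Lemma mix_right A (e p q : nat -> A) :
  (fun i => mix e (mix p q) (mix ev (fun j => od (od j)) i)) = mix e q.
Proof.
  rewrite (comp_mix _ _ (mix e (mix p q))), mix_comp_ev.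
  f_equal. extensionality i. now rewrite !mix_od.
Qed.

Lemma comp_scons A B (h : A -> B) a e : (fun i => h (scons a e i)) = scons (h a) (fun i => h (e i)).
Proof. extensionality i. now destruct i. Qed.

Lemma bounded_renf f : forall r q, bounded f -> bounded (renf r q f).
Proof. induction f; cbn; intuition. Qed.

Section Renaming.
Variable M : L2struct.

Lemma teval_rent e r t : teval M e (rent r t) = teval M (fun i => e (r i)) t.
Proof. induction t; cbn; congruence. Qed.

Lemma scons_up (A : Type) (a : A) e r : (fun i => scons a e (up r i)) = scons a (fun i => e (r i)).
Proof. unfold up. now rewrite comp_scons. Qed.

Lemma feval_renf f : forall e s r q,
  feval M e s (renf r q f) <-> feval M (fun i => e (r i)) (fun i => s (q i)) f.
Proof.
  induction f; intros e s r q; cbn; rewrite ?teval_rent;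
    try (rewrite IHf1, IHf2); try rewrite IHf; try reflexivity;
    (setoid_rewrite IHf; setoid_rewrite scons_up; reflexivity).
Qed.
End Renaming.

Section Model.
Variable M : L2struct.
Hypothesis HM : RCA0 M.
Variable E : S M.

Declare Scope m_scope.
Delimit Scope m_scope with m.
Local Open Scope m_scope.
Local Notation "x + y" := (add M x y) : m_scope.
Local Notation "x * y" := (mul M x y) : m_scope.
Local Notation "x < y" := (lt M x y) : m_scope.
Local Notation "0" := (zero M) : m_scope.
Local Notation "1" := (one M) : m_scope.
Local Notation "x ∈ X" := (mem M x X) (at level 70) : m_scope.
Local Notation env := (nat -> N M).

(** Definability is a property of functions of environments, not of syntax, so that closure lemmas
    can replace the writing of formulas. *)
Definition Tm (t : env -> N M) : Prop :=
  exists tau p, forall e, t e = teval M (mix e p) tau.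

(* Even-numbered variables are the arguments, odd-numbered ones hold the number parameters. *)
Definition D0 (P : env -> Prop) : Prop :=
  exists phi p s, bounded phi /\ forall e, P e <-> feval M (mix e p) s phi.

Lemma Tm_var i : Tm (fun e => e i).
Proof. exists (tvar (ev i)), (fun _ => zero M). intro e. cbn [teval]. now rewrite mix_ev. Qed.

Lemma Tm_const c : Tm (fun _ => c).
Proof. exists (tvar (od 0)), (fun _ => c). intro e. cbn [teval]. now rewrite mix_od. Qed.

(** The two parameter lists are interleaved once more and each term is renamed to read its own
    half. *)
Lemma Tm_merge t u : Tm t -> Tm u -> exists tau ups p,
  forall e, t e = teval M (mix e p) tau /\ u e = teval M (mix e p) ups.
Proof.
  intros [tau [p H]] [ups [q K]].
  exists (rent (mix ev (fun i => od (ev i))) tau), (rent (mix ev (fun i => od (od i))) ups), (mix p q).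
  intro e. rewrite !teval_rent, H, K, mix_left, mix_right. now split.
Qed.

Lemma Tm_add t u : Tm t -> Tm u -> Tm (fun e => t e + u e).
Proof.
  intros Ht Hu. destruct (Tm_merge t u Ht Hu) as (a & b & p & H).
  exists (tadd a b), p. intro e. cbn. now destruct (H e) as [<- <-].
Qed.

Lemma Tm_mul t u : Tm t -> Tm u -> Tm (fun e => t e * u e).
Proof.
  intros Ht Hu. destruct (Tm_merge t u Ht Hu) as (a & b & p & H).
  exists (tmul a b), p. intro e. cbn. now destruct (H e) as [<- <-].
Qed.

Lemma Tm_pair t u : Tm t -> Tm u -> Tm (fun e => pair M (t e) (u e)).
Proof. intros. unfold pair. now apply Tm_add; [apply Tm_mul; apply Tm_add|]. Qed.

Lemma Tm_ren t r : Tm t -> Tm (fun e => t (fun i => e (r i))).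
Proof.
  intros [tau [p H]]. exists (rent (mix (fun i => ev (r i)) od) tau), p.
  intro e. rewrite teval_rent, H, comp_mix, mix_comp_od. f_equal. f_equal.
  extensionality i. now rewrite mix_ev.
Qed.


Lemma D0_eq t u : Tm t -> Tm u -> D0 (fun e => t e = u e).
Proof.
  intros Ht Hu. destruct (Tm_merge t u Ht Hu) as (a & b & p & H).
  exists (feq a b), p, (fun _ => E). split; [exact I|]. intro e. cbn.
  now destruct (H e) as [<- <-].
Qed.

Lemma D0_lt t u : Tm t -> Tm u -> D0 (fun e => t e < u e).
Proof.
  intros Ht Hu. destruct (Tm_merge t u Ht Hu) as (a & b & p & H).
  exists (flt a b), p, (fun _ => E). split; [exact I|]. intro e. cbn.
  now destruct (H e) as [<- <-].
Qed.

Lemma D0_mem t X : Tm t -> D0 (fun e => t e ∈ X).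
Proof.
  intros (a & p & H). exists (fmem a 0), p, (fun _ => X). split; [exact I|].
  intro e. cbn. now rewrite H.
Qed.

Lemma D0_not P : D0 P -> D0 (fun e => ~ P e).
Proof.
  intros (phi & p & s & B & H). exists (fnot phi), p, s. split; [exact B|].
  intro e. cbn. now rewrite H.
Qed.

Lemma D0_merge P Q : D0 P -> D0 Q -> exists phi psi p s, bounded phi /\ bounded psi /\
  (forall e, P e <-> feval M (mix e p) s phi) /\ (forall e, Q e <-> feval M (mix e p) s psi).
Proof.
  intros (phi & p & s & B & H) (psi & q & s' & B' & H').
  exists (renf (mix ev (fun i => od (ev i))) ev phi), (renf (mix ev (fun i => od (od i))) od psi),
    (mix p q), (mix s s').
  repeat split; try (now apply bounded_renf);
    rewrite feval_renf, ?mix_left, ?mix_right, ?mix_comp_ev, ?mix_comp_od;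
    try apply H; try apply H'.
Qed.

Lemma D0_and P Q : D0 P -> D0 Q -> D0 (fun e => P e /\ Q e).
Proof.
  intros HP HQ. destruct (D0_merge P Q HP HQ) as (phi & psi & p & s & B & B' & H & H').
  exists (fand phi psi), p, s. split; [now split|]. intro e. cbn. now rewrite H, H'.
Qed.

Lemma D0_or P Q : D0 P -> D0 Q -> D0 (fun e => P e \/ Q e).
Proof.
  intros HP HQ. destruct (D0_merge P Q HP HQ) as (phi & psi & p & s & B & B' & H & H').
  exists (for_ phi psi), p, s. split; [now split|]. intro e. cbn. now rewrite H, H'.
Qed.

Lemma D0_imp (P Q : env -> Prop) : D0 P -> D0 Q -> D0 (fun e => P e -> Q e).
Proof.
  intros HP HQ. destruct (D0_merge P Q HP HQ) as (phi & psi & p & s & B & B' & H & H').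
  exists (fimp phi psi), p, s. split; [now split|]. intro e. cbn. now rewrite H, H'.
Qed.

(** A binder pushes [x] in front of the whole interleaved environment, whereas the hypothesis has
    [x] in front of the arguments alone; the renaming reconciles the two layouts. *)
Lemma D0_body (t : env -> N M) (P : env -> N M -> Prop) :
  Tm t -> D0 (fun e => P (tl e) (e 0%nat)) ->
  exists a phi p s, bounded phi /\ forall e, t e = teval M (mix e p) a /\
    forall x, P e x <-> feval M (scons x (mix e p)) s phi.
Proof.
  intros (a & p & H) (phi & q & s & B & H').
  exists (rent (mix ev (fun i => od (ev i))) a),
    (renf (mix (scons 0%nat (fun i => sc (ev i))) (fun i => sc (od (od i)))) (fun i => i) phi),
    (mix p q), s.
  split; [now apply bounded_renf|]. intro e. split.
  - now rewrite H, teval_rent, mix_left.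
  - intro x. rewrite feval_renf. rewrite (H' (scons x e)).
    replace (fun i => scons x (mix e (mix p q)) _) with (mix (scons x e) q); [reflexivity|].
    rewrite (comp_mix _ _ (scons x (mix e (mix p q)))), comp_scons. cbn [scons].
    rewrite mix_comp_ev. f_equal. extensionality i. now rewrite !mix_od.
Qed.

Lemma D0_ball t P : Tm t -> D0 (fun e => P (tl e) (e 0%nat)) ->
  D0 (fun e => forall a, a < t e -> P e a).
Proof.
  intros Ht HP. destruct (D0_body t P Ht HP) as (a & phi & p & s & B & H).
  exists (fball a phi), p, s. split; [exact B|]. intro e. cbn.
  destruct (H e) as [T K]. rewrite T. now setoid_rewrite K.
Qed.

Lemma D0_bex t P : Tm t -> D0 (fun e => P (tl e) (e 0%nat)) ->
  D0 (fun e => exists a, a < t e /\ P e a).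
Proof.
  intros Ht HP. destruct (D0_body t P Ht HP) as (a & phi & p & s & B & H).
  exists (fbex a phi), p, s. split; [exact B|]. intro e. cbn.
  destruct (H e) as [T K]. rewrite T. now setoid_rewrite K.
Qed.

Lemma D0_ren P r : D0 P -> D0 (fun e => P (fun i => e (r i))).
Proof.
  intros (phi & p & s & B & H).
  exists (renf (mix (fun i => ev (r i)) od) (fun i => i) phi), p, s.
  split; [now apply bounded_renf|]. intro e.
  rewrite feval_renf, comp_mix, mix_comp_od, H.
  replace (fun i => mix e p (ev (r i))) with (fun i => e (r i)); [reflexivity|].
  extensionality i. now rewrite mix_ev.
Qed.

Definition S1 (P : env -> Prop) : Prop :=
  exists Q, D0 Q /\ forall e, P e <-> exists a, Q (scons a e).

Lemma S1_D0 P : D0 P -> S1 P.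
Proof.
  intro HP. exists (fun e => P (tl e)). split; [exact (D0_ren P sc HP)|].
  intro e. split; [now exists (zero M)|now intros [a H]].
Qed.

(* The variable layout of the induction and comprehension axioms: witness, argument, parameters. *)
Definition layout : nat -> nat :=
  mix (scons 0%nat (scons 1%nat (fun i => sc (sc (ev i))))) (fun i => sc (sc (od i))).

Lemma feval_layout a n p s f :
  feval M (mix (scons a (scons n (fun _ => 0))) p) s f <->
  feval M (scons a (scons n (mix (fun _ => 0) p))) s (renf layout (fun i => i) f).
Proof.
  unfold layout. rewrite feval_renf, (comp_mix _ _ (scons a _)), !comp_scons. cbn [scons].
  now rewrite mix_comp_ev, mix_comp_od.
Qed.

Lemma S1_ind (P : N M -> Prop) : S1 (fun e => P (e 0%nat)) ->
  P 0 -> (forall n, P n -> P (n + 1)) -> forall n, P n.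
Proof.
  intros (Q & (phi & p & s & B & K) & H) P0 PS n. destruct HM as (_ & Ind & _).
  assert (L : forall m, P m <-> feval M (scons m (mix (fun _ => 0) p)) s
      (fex (renf layout (fun i => i) phi))).
  { intro m. cbn [feval]. setoid_rewrite <- feval_layout. setoid_rewrite <- K.
    exact (H (scons m _)). }
  apply L. apply Ind; [|now apply L|].
  { eexists. split; [|reflexivity]. now apply bounded_renf. }
  intros m Hm. apply L, PS, L, Hm.
Qed.

Definition D1 (P : env -> Prop) : Prop := S1 P /\ S1 (fun e => ~ P e).

(** Negating the matrix of the Sigma definition of the complement gives the Pi definition that the
    axiom asks for. *)
Lemma D1_comprehension (P : N M -> Prop) : D1 (fun e => P (e 0%nat)) ->
  exists X, forall n, n ∈ X <-> P n.
Proof.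
  intros [(Q & HQ & H) (Q' & HQ' & H')]. destruct HM as (_ & _ & Cmp).
  destruct (D0_merge Q _ HQ (D0_not _ HQ')) as (phi & psi & p & s & B & B' & K & K').
  pose (e' := mix (fun _ => 0) p).
  assert (Pphi : forall n, P n <-> feval M (scons n e') s (fex (renf layout (fun i => i) phi))).
  { intro n. unfold e'. cbn [feval]. setoid_rewrite <- feval_layout. setoid_rewrite <- K. exact (H (scons n _)). }
  assert (Ppsi : forall n, P n <-> feval M (scons n e') s (fall (renf layout (fun i => i) psi))).
  { intro n. unfold e'. cbn [feval]. setoid_rewrite <- feval_layout. setoid_rewrite <- K'.
    generalize (H' (scons n (fun _ => 0))). cbn [scons]. intro F. split.
    - intros p1 a q. apply F; [now exists a|exact p1].
    - intro q. apply NNPP. intro np. apply F in np. destruct np as [a Ha]. exact (q a Ha). }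
  destruct (Cmp (fex (renf layout (fun i => i) phi)) (fall (renf layout (fun i => i) psi)) e' s) as [X HX].
  - eexists. split; [|reflexivity]. now apply bounded_renf.
  - eexists. split; [|reflexivity]. now apply bounded_renf.
  - intro n. now rewrite <- Pphi, <- Ppsi.
  - exists X. intro n. now rewrite HX, Pphi.
Qed.

(** * Arithmetic *)

Ltac tm := cbv beta delta [tl];
  repeat first [apply Tm_var | apply Tm_const | apply Tm_add | apply Tm_mul | apply Tm_pair
               | assumption].

Ltac d0 := cbv beta delta [tl];
  repeat first [apply D0_eq; [now tm|now tm] | apply D0_lt; [now tm|now tm] | apply D0_mem; now tm
    | apply D0_not | apply D0_and | apply D0_or
    | apply D0_ball; [now tm|cbv beta delta [tl]] | apply D0_bex; [now tm|cbv beta delta [tl]]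
    | apply D0_imp].

Lemma D0_ind (P : N M -> Prop) : D0 (fun e => P (e 0%nat)) ->
  P 0 -> (forall n, P n -> P (n + 1)) -> forall n, P n.
Proof. intro H. apply S1_ind. now apply S1_D0. Qed.

Ltac ind0 x :=
  revert x; match goal with |- forall y, @?P y => apply (D0_ind P); [now d0|cbv beta|cbv beta] end.

Lemma succ_neq0 n : n + 1 <> 0.
Proof. apply HM. Qed.
Lemma succ_inj m n : m + 1 = n + 1 -> m = n.
Proof. apply HM. Qed.
Lemma nlt0 m : ~ m < 0.
Proof. apply HM. Qed.
Lemma lt_succ m n : m < n + 1 <-> m < n \/ m = n.
Proof. apply HM. Qed.
Lemma add0 m : m + 0 = m.
Proof. apply HM. Qed.
Lemma addS m n : m + (n + 1) = m + n + 1.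
Proof. apply HM. Qed.
Lemma mul0 m : m * 0 = 0.
Proof. apply HM. Qed.
Lemma mulS m n : m * (n + 1) = m * n + m.
Proof. apply HM. Qed.

Lemma add_assoc a b c : a + (b + c) = a + b + c.
Proof.
  ind0 c; [now rewrite !add0|]. intros c H. now rewrite !addS, H.
Qed.

Lemma add_0l a : 0 + a = a.
Proof. ind0 a; [now rewrite add0|]. intros a H. now rewrite addS, H. Qed.

Lemma add_1l a : 1 + a = a + 1.
Proof.
  ind0 a; [now rewrite add0, add_0l|]. intros a H. now rewrite addS, H.
Qed.

Lemma add_comm a b : a + b = b + a.
Proof.
  ind0 b; [now rewrite add0, add_0l|]. intros b H.
  now rewrite addS, H, <- !add_assoc, add_1l.
Qed.

Lemma mul_addr a b c : a * (b + c) = a * b + a * c.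
Proof.
  ind0 c; [now rewrite mul0, !add0|]. intros c H.
  now rewrite addS, !mulS, H, add_assoc.
Qed.

Lemma mul_0l a : 0 * a = 0.
Proof. ind0 a; [apply mul0|]. intros a H. now rewrite mulS, H, add0. Qed.

Lemma mul_succl a b : (a + 1) * b = a * b + b.
Proof.
  ind0 b; [now rewrite !mul0, add0|]. intros b H.
  rewrite !mulS, H, !addS. f_equal. rewrite <- !add_assoc. f_equal. apply add_comm.
Qed.

Lemma mul_comm a b : a * b = b * a.
Proof.
  ind0 b; [now rewrite mul0, mul_0l|]. intros b H.
  now rewrite mulS, mul_succl, H.
Qed.

Lemma mul_assoc a b c : a * (b * c) = a * b * c.
Proof.
  ind0 c; [now rewrite !mul0|]. intros c H.
  now rewrite !mulS, mul_addr, H.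
Qed.

Lemma mul_1l a : 1 * a = a.
Proof. rewrite mul_comm, <- (add_0l 1), mulS, mul0. apply add_0l. Qed.

Lemma M_semiring : semi_ring_theory 0 1 (add M) (mul M) eq.
Proof.
  constructor.
  - exact add_0l.
  - exact add_comm.
  - exact add_assoc.
  - exact mul_1l.
  - exact mul_0l.
  - exact mul_comm.
  - exact mul_assoc.
  - intros. rewrite mul_comm, mul_addr. f_equal; apply mul_comm.
Qed.

Add Ring M_ring : M_semiring.

Lemma lt_trans a b c : a < b -> b < c -> a < c.
Proof.
  ind0 c; [intros _ H; now apply nlt0 in H|].
  intros c H ab bc. apply lt_succ in bc. apply lt_succ. left.
  destruct bc as [bc| ->]; auto.
Qed.

Lemma lt_succ_diag n : n < n + 1.
Proof. apply lt_succ. now right. Qed.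

Lemma lt_succ_mono a b : a < b -> a + 1 < b + 1.
Proof.
  ind0 b; [intro H; now apply nlt0 in H|].
  intros b H ab. apply lt_succ in ab. apply lt_succ.
  destruct ab as [ab|ab]; [left; now apply H|right; now rewrite ab].
Qed.

Lemma lt_0_succ n : 0 < n + 1.
Proof.
  ind0 n; [apply lt_succ_diag|].
  intros n H. apply (lt_trans _ _ _ H), lt_succ_diag.
Qed.

Lemma lt_total a b : a < b \/ a = b \/ b < a.
Proof.
  ind0 a; [ |].
  - assert (G : forall c, 0 < c \/ 0 = c).
    { intro c. ind0 c; [now right|]. intros. left. apply lt_0_succ. }
    destruct (G b) as [H|H]; [now left|right; now left].
  - intros a [H|[->|H]].
    + apply lt_succ_mono, lt_succ in H. destruct H as [H|H]; auto.
    + right. right. apply lt_succ_diag.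
    + right. right. apply (lt_trans _ _ _ H), lt_succ_diag.
Qed.

Lemma lt_irrefl a : ~ a < a.
Proof.
  ind0 a; [apply nlt0|].
  intros a H K. apply lt_succ in K. destruct K as [K|K].
  - apply H, (lt_trans _ _ _ (lt_succ_diag a) K).
  - apply H. rewrite <- K at 2. apply lt_succ_diag.
Qed.

(** The language has no symbol for [b <= a]; [b < a + 1] stands for it throughout. *)
Lemma nlt_le a b : ~ a < b <-> b < a + 1.
Proof.
  rewrite lt_succ. split.
  - intro H. destruct (lt_total a b) as [K|[->|K]]; [easy|now right|now left].
  - intros [H| ->] K; [|now apply lt_irrefl in K].
    apply (lt_irrefl a), (lt_trans _ _ _ K H).
Qed.

Lemma le_lt_trans a b c : a < b + 1 -> b < c -> a < c.
Proof. intros H K. apply lt_succ in H. destruct H as [H| ->]; [now apply (lt_trans _ b)|easy]. Qed.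

Lemma lt_le_trans a b c : a < b -> b < c + 1 -> a < c.
Proof. intros H K. apply lt_succ in K. destruct K as [K|<-]; [now apply (lt_trans _ b)|easy]. Qed.

Lemma lt_le a b : a < b -> a < b + 1.
Proof. intro. apply lt_succ. now left. Qed.

Lemma succ_le a b : a < b <-> a + 1 < b + 1.
Proof.
  split; [apply lt_succ_mono|]. intro H. apply (lt_le_trans _ (a + 1)); [apply lt_succ_diag|easy].
Qed.

Lemma lt_add_r a b c : a < b -> a + c < b + c.
Proof.
  intro H. ind0 c; [now rewrite !add0|].
  intros c K. rewrite !addS. now apply lt_succ_mono.
Qed.

Lemma le_add_l a b : a < b + a + 1.
Proof.
  ind0 b; [rewrite add_0l; apply lt_succ_diag|].
  intros b K. apply (lt_trans _ _ _ K). replace (b + 1 + a) with (b + a + 1) by ring. apply lt_succ_diag.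
Qed.

Lemma lt_ex a b : a < b -> exists c, b = a + c + 1.
Proof.
  revert b. intros b ab.
  (* The bound on [c] makes the induction formula bounded. *)
  assert (K : exists c, c < b /\ b = a + c + 1); [|destruct K as [c [_ K]]; now exists c].
  revert ab. ind0 b; [intro H; now apply nlt0 in H|].
  intros b H ab. apply lt_succ in ab. destruct ab as [ab| ->].
  - destruct (H ab) as [c [cb Hc]]. exists (c + 1). split; [now apply lt_succ_mono|].
    rewrite Hc at 1. ring.
  - exists 0. split; [apply lt_0_succ|ring].
Qed.

Lemma le_ex a b : a < b + 1 <-> exists c, b = a + c.
Proof.
  split.
  - rewrite lt_succ. intros [H| ->]; [|exists 0; ring].
    destruct (lt_ex _ _ H) as [c ->]. exists (c + 1). ring.
  - intros [c ->]. rewrite (add_comm a c). apply le_add_l.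
Qed.

(** For [s = i + j] the code of a pair lies between [s * s] and [s * s + s], so this separates the
    codes of pairs with different sums. *)
Lemma square_mono a b : a < b -> a * a + a < b * b.
Proof.
  intro H. destruct (lt_ex _ _ H) as [c ->].
  apply succ_le, le_ex. exists (a * c + a * c + c * c + a + c + c).
  ring.
Qed.

Lemma pair_lt i j i' j' : i + j < i' + j' -> pair M i j < pair M i' j'.
Proof.
  intro H. unfold pair. apply square_mono in H.
  apply (le_lt_trans _ ((i + j) * (i + j) + (i + j))).
  - apply le_ex. exists j. ring.
  - apply (lt_le_trans _ _ _ H). apply le_ex. now exists i'.
Qed.

Lemma add_cancel a b c : c + a = c + b -> a = b.
Proof.
  intro H. destruct (lt_total a b) as [K|[K|K]]; [|easy|].
  - apply (lt_add_r _ _ c) in K. rewrite add_comm, H, add_comm in K. now apply lt_irrefl in K.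
  - apply (lt_add_r _ _ c) in K. rewrite add_comm, <- H, add_comm in K. now apply lt_irrefl in K.
Qed.

Lemma pair_inj i j i' j' : pair M i j = pair M i' j' -> i = i' /\ j = j'.
Proof.
  intro H. assert (K : i + j = i' + j').
  { destruct (lt_total (i + j) (i' + j')) as [K|[K|K]]; [|easy|];
    apply pair_lt in K; rewrite H in K; now apply lt_irrefl in K. }
  unfold pair in H. rewrite K in H. apply add_cancel in H as ->.
  split; [easy|]. now apply add_cancel in K.
Qed.

Lemma pair_le1 i j : i < pair M i j + 1.
Proof. unfold pair. apply le_add_l. Qed.

Lemma pair_le2 i j : j < pair M i j + 1.
Proof.
  destruct (lt_total j 0) as [H|[->|H]]; [now apply nlt0 in H| |].
  - apply lt_0_succ.
  - destruct (lt_ex _ _ H) as [c ->]. unfold pair. apply le_ex.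
    exists (i * i + (i + i) * (c + 1) + c * (c + 1) + i). ring.
Qed.

Lemma common_bound a b : exists c, a < c /\ b < c.
Proof.
  exists (a + b + 1). split; [|apply le_add_l]. rewrite (add_comm a b). apply le_add_l.
Qed.

(** * Closure properties and induction *)

Lemma S1_ext (P Q : env -> Prop) : (forall e, P e <-> Q e) -> S1 P -> S1 Q.
Proof. intros H (R & HR & K). exists R. split; [easy|]. intro e. now rewrite <- H. Qed.

(** Slot 0 holds a witness and slot 1 the bound put on it; [Q] must not see the bound. *)
Lemma D0_slots2 Q : D0 Q -> D0 (fun e => Q (scons (e 0%nat) (tl (tl e)))).
Proof.
  intro H. apply (D0_ren Q (scons 0%nat (fun i => sc (sc i)))) in H.
  destruct H as (phi & p & s & B & H). exists phi, p, s. split; [easy|]. intro e.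
  rewrite <- H. now rewrite (comp_scons _ _ e).
Qed.

Lemma D0_slots3 Q : D0 Q -> D0 (fun e => Q (scons (e 0%nat) (scons (e 1%nat) (tl (tl (tl e)))))).
Proof.
  intro H. apply (D0_ren Q (scons 0%nat (scons 1%nat (fun i => sc (sc (sc i)))))) in H.
  destruct H as (phi & p & s & B & H). exists phi, p, s. split; [easy|]. intro e.
  rewrite <- H. now rewrite !(comp_scons _ _ e).
Qed.

(** The single unbounded witness is a common bound for the two original ones. *)
Lemma S1_and P Q : S1 P -> S1 Q -> S1 (fun e => P e /\ Q e).
Proof.
  intros (P' & HP & KP) (Q' & HQ & KQ).
  exists (fun e => (exists a, a < e 0%nat /\ P' (scons a (tl e))) /\
                   (exists a, a < e 0%nat /\ Q' (scons a (tl e)))).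
  split.
  - apply D0_and; apply D0_bex; try apply Tm_var; now apply D0_slots2.
  - intro e. rewrite KP, KQ. split.
    + intros [[a Ha] [b Hb]]. destruct (common_bound a b) as (c & ac & bc).
      exists c. split; [now exists a|now exists b].
    + intros [c [[a [_ Ha]] [b [_ Hb]]]]. split; [now exists a|now exists b].
Qed.

Lemma S1_or P Q : S1 P -> S1 Q -> S1 (fun e => P e \/ Q e).
Proof.
  intros (P' & HP & KP) (Q' & HQ & KQ).
  exists (fun e => P' e \/ Q' e). split; [now apply D0_or|].
  intro e. rewrite KP, KQ. split.
  - intros [[a H]|[a H]]; exists a; auto.
  - intros [a [H|H]]; [left|right]; now exists a.
Qed.

Lemma S1_ex (P : env -> N M -> Prop) : S1 (fun e => P (tl e) (e 0%nat)) ->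
  S1 (fun e => exists a, P e a).
Proof.
  intros (Q & HQ & K).
  exists (fun e => exists a, a < e 0%nat /\ exists b, b < e 0%nat /\ Q (scons b (scons a (tl e)))).
  split.
  - apply D0_bex; [apply Tm_var|]. apply (D0_bex (fun e => tl e 0%nat)); [apply (Tm_var 1)|].
    now apply D0_slots3.
  - intro e. split.
    + intros [a Ha]. apply (K (scons a e)) in Ha. destruct Ha as [b Hb].
      destruct (common_bound a b) as (c & ac & bc).
      exists c, a. split; [easy|]. now exists b.
    + intros (c & a & _ & b & _ & H). exists a. apply (K (scons a e)). now exists b.
Qed.

(* Pulling the witness out of the bounded quantifier is Sigma^0_1 collection. *)
Lemma S1_ball (t : env -> N M) (P : env -> N M -> Prop) :
  Tm t -> S1 (fun e => P (tl e) (e 0%nat)) -> S1 (fun e => forall a, a < t e -> P e a).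
Proof.
  intros Ht (Q & HQ & K).
  assert (D : forall u, Tm u -> D0 (fun e => forall a, a < u (tl e) ->
      exists b, b < e 0%nat /\ Q (scons b (scons a (tl e))))).
  { intros u Hu. apply (D0_ball (fun e => u (tl e))); [exact (Tm_ren u sc Hu)|].
    apply (D0_bex (fun e => tl e 0%nat)); [apply (Tm_var 1)|]. now apply D0_slots3. }
  exists (fun e => forall a, a < t (tl e) -> exists b, b < e 0%nat /\ Q (scons b (scons a (tl e)))).
  split; [now apply D|].
  intro e. split.
  - intro H.
    assert (G : forall n, exists c, forall a, a < n -> a < t e ->
        exists b, b < c /\ Q (scons b (scons a e))).
    { apply S1_ind.
      - destruct HQ as (phi & p & s & B & HQ).
        (* The induction runs on [n] alone, so the outer environment [e] is frozen into the
           parameters. *)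
        pose (Q' := fun e' : env => feval M (mix (scons (e' 0%nat) (scons (e' 1%nat) e)) p) s phi).
        exists (fun e' => forall a, a < e' 1%nat -> a < t e ->
          exists b, b < e' 0%nat /\ Q' (scons b (scons a (tl e')))).
        split.
        + apply (D0_ball (fun e => e 1%nat)); [tm|]. apply D0_imp; [d0; tm|].
          apply (D0_bex (fun e => tl e 0%nat)); [tm|].
          unfold Q'. cbn [scons].
          exists (renf (mix (scons (ev 0) (scons (ev 1) (fun i => od (ev i)))) (fun i => od (od i)))
            (fun i => i) phi), (mix e p), s.
          split; [now apply bounded_renf|]. intro e'.
          rewrite feval_renf.
          replace (fun i => mix e' (mix e p) _) with (mix (scons (e' 0%nat) (scons (e' 1%nat) e)) p);
            [reflexivity|].
          rewrite (comp_mix _ _ (mix e' (mix e p))), !comp_scons, !mix_ev.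
          f_equal; [|extensionality i; now rewrite !mix_od].
          f_equal. f_equal. extensionality i. now rewrite mix_od, mix_ev.
        + intro e'. unfold Q'. cbn [scons]. setoid_rewrite <- HQ. reflexivity.
      - exists 0. intros a Ha. now apply nlt0 in Ha.
      - intros n [c Hc]. destruct (classic (n < t e)) as [L|L].
        + apply H, (K (scons n e)) in L. destruct L as [b Hb].
          destruct (common_bound b c) as (d & bd & cd). exists d. intros a an at_.
          apply lt_succ in an. destruct an as [an| ->]; [|now exists b].
          destruct (Hc a an at_) as (b' & b'c & Hb'). exists b'. split; [|easy].
          now apply (lt_trans _ c).
        + exists c. intros a an at_. apply lt_succ in an. destruct an as [an| ->]; [auto|easy]. }
    destruct (G (t e)) as [c Hc]. exists c. intros a at_. now apply Hc.
  - intros [c Hc] a Ha. apply (K (scons a e)). destruct (Hc a Ha) as (b & _ & Hb). now exists b.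
Qed.

Lemma S1_bex (t : env -> N M) (P : env -> N M -> Prop) :
  Tm t -> S1 (fun e => P (tl e) (e 0%nat)) -> S1 (fun e => exists a, a < t e /\ P e a).
Proof.
  intros Ht H. apply S1_ex. apply S1_and; [|exact H].
  apply S1_D0, D0_lt; [apply Tm_var|exact (Tm_ren t sc Ht)].
Qed.

Lemma D1_D0 P : D0 P -> D1 P.
Proof. intro H. split; apply S1_D0; [easy|now apply D0_not]. Qed.

Lemma D1_S1 P : D1 P -> S1 P.
Proof. now intros []. Qed.

Lemma D1_ext (P Q : env -> Prop) : (forall e, P e <-> Q e) -> D1 P -> D1 Q.
Proof.
  intros H [K L]. split; [now apply (S1_ext P)|].
  apply (S1_ext (fun e => ~ P e)); [|easy]. intro e. now rewrite H.
Qed.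

Lemma D1_not P : D1 P -> D1 (fun e => ~ P e).
Proof.
  intros [H K]. split; [easy|]. apply (S1_ext P); [|easy].
  intro e. split; [tauto|apply NNPP].
Qed.

Lemma D1_and P Q : D1 P -> D1 Q -> D1 (fun e => P e /\ Q e).
Proof.
  intros [H K] [H' K']. split; [now apply S1_and|].
  apply (S1_ext (fun e => ~ P e \/ ~ Q e)); [|now apply S1_or]. intro e. tauto.
Qed.

Lemma D1_or P Q : D1 P -> D1 Q -> D1 (fun e => P e \/ Q e).
Proof.
  intros [H K] [H' K']. split; [now apply S1_or|].
  apply (S1_ext (fun e => ~ P e /\ ~ Q e)); [|now apply S1_and]. intro e. tauto.
Qed.

Lemma D1_imp (P Q : env -> Prop) : D1 P -> D1 Q -> D1 (fun e => P e -> Q e).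
Proof.
  intros H K. apply (D1_ext (fun e => ~ P e \/ Q e)); [intro e; tauto|].
  apply D1_or; [now apply D1_not|easy].
Qed.

Lemma D1_iff (P Q : env -> Prop) : D1 P -> D1 Q -> D1 (fun e => P e <-> Q e).
Proof. intros H K. apply D1_and; now apply D1_imp. Qed.

Lemma D1_ball t P : Tm t -> D1 (fun e => P (tl e) (e 0%nat)) ->
  D1 (fun e => forall a, a < t e -> P e a).
Proof.
  intros Ht [H K]. split; [now apply S1_ball|].
  apply (S1_ext (fun e => exists a, a < t e /\ ~ P e a));
    [|exact (S1_bex t (fun e a => ~ P e a) Ht K)].
  intro e. split; [firstorder|]. intro F. apply NNPP. intro G. apply F.
  intros a Ha. apply NNPP. intro. apply G. now exists a.
Qed.

Lemma D1_bex t P : Tm t -> D1 (fun e => P (tl e) (e 0%nat)) ->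
  D1 (fun e => exists a, a < t e /\ P e a).
Proof.
  intros Ht H. apply D1_not in H. apply (D1_ball t (fun e a => ~ P e a) Ht), D1_not in H.
  refine (D1_ext _ _ _ H). intro e. split; [|firstorder].
  intro F. apply NNPP. intro G. apply F. intros a Ha K. apply G. now exists a.
Qed.

Lemma D1_eq t u : Tm t -> Tm u -> D1 (fun e => t e = u e).
Proof. intros. now apply D1_D0, D0_eq. Qed.
Lemma D1_lt t u : Tm t -> Tm u -> D1 (fun e => t e < u e).
Proof. intros. now apply D1_D0, D0_lt. Qed.
Lemma D1_mem t X : Tm t -> D1 (fun e => t e ∈ X).
Proof. intros. now apply D1_D0, D0_mem. Qed.

(* A D1 predicate is a set, so substitution of terms reduces to membership. *)
Lemma D1_sub1 (P : N M -> Prop) t : D1 (fun e => P (e 0%nat)) -> Tm t -> D1 (fun e => P (t e)).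
Proof.
  intros H Ht. destruct (D1_comprehension P H) as [X HX].
  apply (D1_ext (fun e => t e ∈ X)); [intro; apply HX|now apply D1_mem].
Qed.

Lemma S1_ren P r : S1 P -> S1 (fun e => P (fun i => e (r i))).
Proof.
  intros (Q & HQ & K). exists (fun e => Q (fun i => e (up r i))). split; [now apply D0_ren|].
  intro e. rewrite K. now setoid_rewrite scons_up.
Qed.

Lemma D1_ren P r : D1 P -> D1 (fun e => P (fun i => e (r i))).
Proof. intros [H K]. split; [now apply S1_ren|exact (S1_ren _ r K)]. Qed.

(** The binary relation is turned into a set of pairs, where substitution is again membership of a
    term. *)
Lemma D1_sub2 (R : N M -> N M -> Prop) t u :
  D1 (fun e => R (e 0%nat) (e 1%nat)) -> Tm t -> Tm u -> D1 (fun e => R (t e) (u e)).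
Proof.
  intros H Ht Hu.
  destruct (D1_comprehension (fun n => exists x, x < n + 1 /\ exists y, y < n + 1 /\
    n = pair M x y /\ R x y)) as [X HX].
  { apply (D1_bex (fun e => e 0%nat + 1)); [tm|].
    apply (D1_bex (fun e => tl e 0%nat + 1)); [tm|].
    apply D1_and; [apply D1_eq; tm|].
    (* Under the two quantifiers [x] has index 1 and [y] index 0, hence the swap. *)
    exact (D1_ren _ (fun i => match i with 0%nat => 1%nat | _ => 0%nat end) H). }
  apply (D1_ext (fun e => pair M (t e) (u e) ∈ X)); [|apply D1_mem; tm].
  intro e. rewrite HX. split.
  - intros (x & _ & y & _ & K & L). apply pair_inj in K as [-> ->]. exact L.
  - intro K. exists (t e). split; [apply pair_le1|]. exists (u e). split; [apply pair_le2|easy].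
Qed.

(** An extension point of [d1], redefined whenever a new relation has been shown to be Delta^0_1. *)
Ltac d1_hook := fail.
Ltac d1 := cbv beta delta [tl];
  repeat first [apply D1_eq; [now tm|now tm] | apply D1_lt; [now tm|now tm] | apply D1_mem; now tm
    | match goal with H : D1 (fun e => ?P (e 0%nat)) |- D1 (fun e => ?P _) =>
        apply (D1_sub1 P _ H); now tm end
    | match goal with H : D1 (fun e => ?P (e 0%nat) (e 1%nat)) |- D1 (fun e => ?P _ _) =>
        apply (D1_sub2 P _ _ H); now tm end
    | d1_hook
    | apply D1_iff | apply D1_not | apply D1_and | apply D1_or
    | apply D1_ball; [now tm|cbv beta delta [tl]] | apply D1_bex; [now tm|cbv beta delta [tl]]
    | apply D1_imp].
Ltac s1 := cbv beta delta [tl];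
  first [apply D1_S1; now d1 | apply S1_ex; s1 | apply S1_and; s1 | apply S1_or; s1
    | apply S1_ball; [now tm|s1]].

(** A failure at [n] descends: by Sigma^0_1 induction on [k] there is a failure at the [m] with
    [m + k = n], and finally at 0. *)
Lemma P1_ind (P : N M -> Prop) : S1 (fun e => ~ P (e 0%nat)) ->
  P 0 -> (forall n, P n -> P (n + 1)) -> forall n, P n.
Proof.
  intros H P0 PS n. apply NNPP. intro nP.
  assert (K : forall k, k < n + 1 -> exists m, m + k = n /\ ~ P m).
  { apply (S1_ind (fun k => k < n + 1 -> exists m, m + k = n /\ ~ P m)).
    - apply (S1_ext (fun e => ~ e 0%nat < n + 1 \/ exists m, m + e 0%nat = n /\ ~ P m));
        [intro e; tauto|].
      apply S1_or; [s1|]. apply S1_ex, S1_and; [s1|exact H].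
    - intros _. exists n. split; [apply add0|easy].
    - intros k IH L. destruct IH as (m & K & L').
      { apply (lt_trans _ _ _ (lt_succ_diag k) L). }
      destruct (lt_total m 0) as [Z|[->|Z]]; [now apply nlt0 in Z|easy|].
      destruct (lt_ex _ _ Z) as [m' ->]. rewrite add_0l in *. exists m'. split.
      + rewrite <- K. ring.
      + intro F. now apply L', PS. }
  destruct (K n) as (m & L & F); [apply lt_succ_diag|].
  assert (m = 0) as ->; [|easy].
  apply (add_cancel _ _ n). rewrite add0, add_comm. exact L.
Qed.

Lemma S1_least (P : N M -> Prop) : S1 (fun e => P (e 0%nat)) ->
  (exists n, P n) -> exists n, P n /\ forall m, m < n -> ~ P m.
Proof.
  intros H [n Pn]. apply NNPP. intro F.
  assert (K : forall k m, m < k -> ~ P m).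
  { apply (P1_ind (fun k => forall m, m < k -> ~ P m)).
    - apply (S1_ext (fun e => exists m, m < e 0%nat /\ P m)).
      + intro e. split; [firstorder|]. intro G. apply NNPP. intro L. apply G.
        intros m Hm Pm. apply L. now exists m.
      + apply S1_bex; [tm|exact H].
    - intros m Hm. now apply nlt0 in Hm.
    - intros k IH m Hm Pm. apply lt_succ in Hm. destruct Hm as [Hm| ->]; [now apply (IH m)|].
      apply F. now exists k. }
  exact (K (n + 1) n (lt_succ_diag n) Pn).
Qed.

(** The greatest element is the one at least distance [d] from the bound [q]. *)
Lemma S1_greatest (P : N M -> Prop) q : S1 (fun e => P (e 0%nat)) ->
  (forall n, P n -> n < q + 1) -> (exists n, P n) -> exists n, P n /\ forall m, P m -> m < n + 1.
Proof.
  intros H B [n Pn].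
  destruct (S1_least (fun d => exists s, s + d = q /\ P s)) as (d & (s & K & Ps) & L).
  - apply S1_ex, S1_and; [s1|exact H].
  - destruct (proj1 (le_ex _ _) (B n Pn)) as [d ->]. now exists d, n.
  - exists s. split; [easy|]. intros m Pm. apply nlt_le. intro sm.
    destruct (proj1 (le_ex _ _) (B m Pm)) as [d' Hd].
    apply (L d'); [|now exists m].
    destruct (lt_ex _ _ sm) as [c ->]. apply succ_le, le_ex. exists c.
    apply (add_cancel _ _ s). rewrite K, Hd. ring.
Qed.

(** * Rado graphs and the lexicographic order *)

Hypothesis HE : is_rado_graph M E.
Local Notation adj := (adj M E).

Lemma D1_adj t u : Tm t -> Tm u -> D1 (fun e => adj (t e) (u e)).
Proof. intros. unfold Defs.adj. d1. Qed.

Ltac d1_hook ::= apply D1_adj; [now tm|now tm].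

Lemma adj_irrefl x : ~ adj x x.
Proof. apply HE. Qed.

Lemma adj_sym x y : adj x y -> adj y x.
Proof. apply HE. Qed.

(* Finite sets are coded by vertices: [v] stands for its set of neighbours below [b]. *)
Lemma vertex_code (P : N M -> Prop) b : D1 (fun e => P (e 0%nat)) ->
  exists v, b < v + 1 /\ forall u, u < b -> (adj v u <-> P u).
Proof.
  intro HP. destruct HE as [_ Rado].
  destruct (D1_comprehension (fun u => u < b)) as [A HA]; [d1|].
  destruct (D1_comprehension (fun u => u < 0)) as [Z HZ]; [d1|].
  destruct (D1_comprehension (fun u => u < b /\ P u)) as [F0 H0]; [d1|].
  (* This [u] is adjacent to everything below [b]; a vertex not adjacent to [u] is therefore at
     least [b]. *)
  destruct (Rado A Z) as (u & Hu & _).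
  { exists b. intro m. apply HA. }
  { exists b. intros m Hm. now apply HZ, nlt0 in Hm. }
  { intros x _ Hx. now apply HZ, nlt0 in Hx. }
  assert (ub : ~ u < b). { intro K. apply (adj_irrefl u), Hu, HA, K. }
  destruct (D1_comprehension (fun x => (x < b /\ ~ P x) \/ x = u)) as [F1 H1]; [d1|].
  destruct (Rado F0 F1) as (v & V0 & V1).
  { exists b. intro m. rewrite H0. tauto. }
  { destruct (common_bound b u) as (c & bc & uc). exists c. intros m Hm.
    apply H1 in Hm. destruct Hm as [[Hm _]| ->]; [now apply (lt_trans _ b)|easy]. }
  { intros x Hx Kx. apply H0 in Hx. apply H1 in Kx. destruct Kx as [Kx| ->]; tauto. }
  exists v. split.
  - apply nlt_le. intro vb. destruct (classic (P v)) as [Pv|Pv].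
    + apply (adj_irrefl v), V0, H0. now split.
    + apply (V1 u); [apply H1; now right|]. apply adj_sym, Hu, HA, vb.
  - intros x xb. split.
    + intro K. apply NNPP. intro L. apply (V1 x); [apply H1; left; now split|easy].
    + intro K. apply V0, H0. now split.
Qed.

(** The classes of [agree n] are the nodes of level [n] in the tree of adjacency sequences, which
    [lexlt] orders lexicographically. *)
Definition agree (n x y : N M) : Prop := forall z, z < n -> (adj x z <-> adj y z).
Definition lexlt (x y : N M) : Prop := exists z, agree z x y /\ ~ adj x z /\ adj y z.

Lemma D1_agree t u w : Tm t -> Tm u -> Tm w -> D1 (fun e => agree (t e) (u e) (w e)).
Proof.
  intros Ht Hu Hw. unfold agree. apply D1_ball; [easy|].
  apply (Tm_ren _ sc) in Hu, Hw. unfold tl. d1.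
Qed.

Lemma agree_refl n x : agree n x x.
Proof. intros z _. reflexivity. Qed.

Lemma agree_sym n x y : agree n x y -> agree n y x.
Proof. intros H z L. symmetry. auto. Qed.

Lemma agree_trans n x y z : agree n x y -> agree n y z -> agree n x z.
Proof. intros H K u L. rewrite (H u L). auto. Qed.

Lemma agree_mono m n x y : m < n + 1 -> agree n x y -> agree m x y.
Proof. intros L H z Hz. apply H, (lt_le_trans _ _ _ Hz L). Qed.

Ltac d1_hook ::=
  first [apply D1_adj; [now tm|now tm] | apply D1_agree; [now tm|now tm|now tm]].

Lemma first_difference n x y : ~ agree n x y ->
  exists z, z < n /\ agree z x y /\ ~ (adj x z <-> adj y z).
Proof.
  intro H. destruct (S1_least (fun z => z < n /\ ~ (adj x z <-> adj y z))) as (z & [zn K] & L).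
  - s1.
  - apply NNPP. intro F. apply H. intros z Hz. apply NNPP. intro. apply F. now exists z.
  - exists z. split; [easy|split; [|easy]]. intros u Hu. apply NNPP. intro F.
    apply (L u Hu). split; [|easy]. now apply (lt_trans _ z).
Qed.

Lemma disagree_lexlt n x y : ~ agree n x y -> lexlt x y \/ lexlt y x.
Proof.
  intro H. destruct (first_difference n x y H) as (z & _ & K & L).
  destruct (classic (adj y z)) as [Y|Y].
  - left. exists z. tauto.
  - right. exists z. split; [now apply agree_sym|]. tauto.
Qed.

(** Some vertex is adjacent to [x] and not to [y], so distinct vertices have distinct adjacency
    sequences. *)
Lemma lexlt_total x y : x <> y -> lexlt x y \/ lexlt y x.
Proof.
  intro H. destruct (common_bound x y) as (b & xb & yb).
  destruct (vertex_code (fun u => u = x) b) as (v & _ & K); [d1|].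
  apply (disagree_lexlt (v + 1)). intro F. specialize (F v (lt_succ_diag v)).
  apply H. symmetry. apply K; [easy|]. apply adj_sym, F, adj_sym, K; easy.
Qed.

Lemma lexlt_trans x y w : lexlt x y -> lexlt y w -> lexlt x w.
Proof.
  intros (z & A1 & X1 & Y1) (z' & A2 & Y2 & W2).
  destruct (lt_total z z') as [L|[->|L]]; [|easy|].
  - exists z. split; [|split; [easy|now apply A2]].
    apply (agree_trans _ _ y); [easy|]. apply (agree_mono _ z'); [now apply lt_le|easy].
  - exists z'. split; [|split; [|easy]].
    + apply (agree_trans _ _ y); [|easy]. apply (agree_mono _ z); [now apply lt_le|easy].
    + now rewrite (A1 z' L).
Qed.

Lemma lexlt_irrefl x : ~ lexlt x x.
Proof. now intros (z & _ & H & K). Qed.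

Lemma lexlt_asym x y : lexlt x y -> ~ lexlt y x.
Proof. intros H K. apply (lexlt_irrefl x), (lexlt_trans _ y); easy. Qed.

Lemma lexlt_before n x y : lexlt x y -> ~ agree n x y ->
  exists z, z < n /\ agree z x y /\ ~ adj x z /\ adj y z.
Proof.
  intros (z & A1 & X1 & Y1) H. exists z. split; [|easy].
  apply NNPP. intro L. apply nlt_le in L. now apply H, (agree_mono _ z).
Qed.

Lemma lexlt_agree n x x' y y' : agree n x x' -> agree n y y' -> ~ agree n x y ->
  lexlt x y -> lexlt x' y'.
Proof.
  intros X Y H K. destruct (lexlt_before n x y K H) as (z & zn & A1 & X1 & Y1).
  exists z. split; [|split; [now rewrite <- (X z zn)|now apply Y]].
  apply (agree_trans _ _ x); [|apply (agree_trans _ _ y); [easy|]].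
  - apply agree_sym, (agree_mono _ n); [now apply lt_le|easy].
  - apply (agree_mono _ n); [now apply lt_le|easy].
Qed.

(** By totality the complement is equality or the reverse order, which is Sigma^0_1 as well. *)
Lemma D1_lexlt t u : Tm t -> Tm u -> D1 (fun e => lexlt (t e) (u e)).
Proof.
  apply D1_sub2. split.
  - unfold lexlt. s1.
  - apply (S1_ext (fun e => e 0%nat = e 1%nat \/ lexlt (e 1%nat) (e 0%nat))).
    + intro e. split.
      * intros [->|H]; [apply lexlt_irrefl|now apply lexlt_asym].
      * intro H. destruct (classic (e 0%nat = e 1%nat)) as [|K]; [now left|right].
        destruct (lexlt_total _ _ K); easy.
    + unfold lexlt. s1.
Qed.

Ltac d1_hook ::=
  first [apply D1_adj; [now tm|now tm] | apply D1_agree; [now tm|now tm|now tm]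
    | apply D1_lexlt; [now tm|now tm]].

(** * Course-of-values recursion, greedy sets and binary values *)

(** The history of the recursion below [x] is coded by the neighbours of a vertex [v]. Codes of
    correct histories exist by Sigma^0_1 induction, and any two of them agree. *)
Lemma course_of_values (Phi : N M -> N M -> Prop) :
  D1 (fun e => Phi (e 0%nat) (e 1%nat)) ->
  (forall x v v', agree x v v' -> (Phi x v <-> Phi x v')) ->
  exists H, forall x v, (forall z, z < x -> (adj v z <-> z ∈ H)) -> (x ∈ H <-> Phi x v).
Proof.
  intros HP Ext.
  pose (Good v x := forall z, z < x -> (adj v z <-> Phi z v)).
  assert (Ex : forall x, exists v, Good v x).
  { apply S1_ind.
    - unfold Good. s1.
    - exists 0. intros z Hz. now apply nlt0 in Hz.
    - intros x [v Hv].
      destruct (vertex_code (fun z => (z < x /\ adj v z) \/ (z = x /\ Phi z v)) (x + 1))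
        as (v' & _ & K); [d1|].
      assert (A : agree x v v').
      { intros z Hz. rewrite K; [|now apply lt_le].
        split; [now left|]. intros [[_ F]|[-> _]]; [easy|now apply lt_irrefl in Hz]. }
      exists v'. intros z Hz. rewrite (K z Hz). apply lt_succ in Hz. destruct Hz as [Hz| ->].
      + rewrite <- (Ext z v v'); [|apply (agree_mono _ x); [now apply lt_le|easy]].
        rewrite <- (Hv z Hz). split; [|now left].
        intros [[_ F]|[-> _]]; [easy|now apply lt_irrefl in Hz].
      + rewrite <- (Ext x v v' A). split; [|now right].
        intros [[F _]|[_ F]]; [now apply lt_irrefl in F|easy]. }
  assert (Un : forall x v v', Good v x -> Good v' x -> agree x v v').
  { intros x v v' G G'. apply NNPP. intro F.
    destruct (first_difference x v v' F) as (z & zx & A & D).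
    apply D. now rewrite (G z zx), (G' z zx), (Ext z v v' A). }
  (* As correct histories exist and agree, non-membership is also witnessed by one of them. *)
  destruct (D1_comprehension (fun x => exists v, Good v (x + 1) /\ adj v x)) as [H HH].
  { split; [unfold Good; s1|].
    apply (S1_ext (fun e => exists v, Good v (e 0%nat + 1) /\ ~ adj v (e 0%nat)));
      [|unfold Good; s1].
    intro e. split.
    - intros (v & Hv & L) (v' & Hv' & L'). apply L.
      now apply (Un _ _ _ Hv Hv' _ (lt_succ_diag _)).
    - intro F. destruct (Ex (e 0%nat + 1)) as [v Hv]. exists v. split; [easy|].
      intro L. apply F. now exists v. }
  exists H. intros x v Hv. destruct (Ex (x + 1)) as [w Hw].
  assert (Hx : forall z, z < x + 1 -> (z ∈ H <-> adj w z)).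
  { intros z Hz. rewrite HH. split.
    - intros (w' & G & L). assert (A : agree (z + 1) w' w).
      { apply Un; [easy|]. intros u Hu. apply Hw, (lt_le_trans _ _ _ Hu).
        now apply lt_succ_mono. }
      apply A; [apply lt_succ_diag|easy].
    - intro L. exists w. split; [|easy]. intros u Hu. apply Hw, (lt_le_trans _ _ _ Hu).
      now apply lt_succ_mono. }
  rewrite (Hx x (lt_succ_diag x)), (Hw x (lt_succ_diag x)). apply Ext.
  intros z Hz. rewrite (Hv z Hz), (Hx z); [easy|now apply lt_le].
Qed.

(* The greedy set of the relation [R]; infinitude only asks for extensions of its initial segments. *)
Lemma greedy_set (A : N M -> Prop) (R : N M -> N M -> Prop) :
  D1 (fun e => A (e 0%nat)) -> D1 (fun e => R (e 0%nat) (e 1%nat)) ->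
  exists H, (forall x, x ∈ H -> A x) /\ (forall x y, x ∈ H -> y ∈ H -> x < y -> R x y) /\
    ((forall b, exists x, b < x + 1 /\ A x /\ forall u, u < b -> u ∈ H -> R u x) ->
     forall b, exists x, b < x + 1 /\ x ∈ H).
Proof.
  intros HA HR.
  destruct (course_of_values (fun x v => A x /\ forall u, u < x -> adj v u -> R u x)) as [H HH].
  - d1.
  - intros x v v' K. split; intros [L G]; (split; [easy|]); intros u Hu F; apply G; try easy;
      now apply K.
  - assert (HH' : forall x, x ∈ H <-> A x /\ forall u, u < x -> u ∈ H -> R u x).
    { intro x. destruct (vertex_code (fun z => z ∈ H) x) as (v & _ & K); [d1|].
      rewrite (HH x v K). split; intros [L G]; (split; [easy|]); intros u Hu F; apply G; try easy;
        now apply K. }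
    exists H. split; [|split].
    + intros x Hx. now apply HH' in Hx.
    + intros x y Hx Hy L. apply HH' in Hy. now apply Hy.
    (* If [H] stopped before [b], an extension of its part below [b] would be compatible with every
       earlier element and enter [H]. *)
    + intros F b. apply NNPP. intro G. destruct (F b) as (x & bx & Ax & K). apply G.
      exists x. split; [easy|]. apply HH'. split; [easy|]. intros u ux Hu. apply K; [|easy].
      apply NNPP. intro L. apply G. exists u. split; [now apply nlt_le|easy].
Qed.

(** By transitivity, an extension of an initial segment only has to respect the last element
    chosen. *)
Lemma chain_set (A : N M -> Prop) (R : N M -> N M -> Prop) :
  D1 (fun e => A (e 0%nat)) -> D1 (fun e => R (e 0%nat) (e 1%nat)) ->
  (forall x y z, R x y -> R y z -> R x z) ->
  (forall b, exists x, b < x + 1 /\ A x) ->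
  (forall x b, A x -> exists y, b < y + 1 /\ A y /\ R x y) ->
  exists H, (forall x, x ∈ H -> A x) /\ (forall x y, x ∈ H -> y ∈ H -> x < y -> R x y) /\
    forall b, exists x, b < x + 1 /\ x ∈ H.
Proof.
  intros HA HR Tr In Ext. destruct (greedy_set A R HA HR) as (H & H1 & H2 & H3).
  exists H. split; [easy|split; [easy|]]. apply H3. intro b.
  destruct (classic (exists u, u < b /\ u ∈ H)) as [K|K].
  - destruct (S1_greatest (fun u => u < b /\ u ∈ H) b) as (u & [ub uH] & L).
    + s1.
    + intros n [Hn _]. now apply lt_le.
    + easy.
    + destruct (Ext u b (H1 u uH)) as (y & yb & Ay & Ry). exists y. split; [easy|split; [easy|]].
      intros w wb wH. assert (L' := L w (conj wb wH)). apply lt_succ in L'.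
      destruct L' as [L'| ->]; [|easy]. apply (Tr _ u); [|easy]. now apply H2.
  - destruct (In b) as (x & bx & Ax). exists x. split; [easy|split; [easy|]].
    intros u ub uH. exfalso. apply K. now exists u.
Qed.

(* [s] is the number whose binary digits are the adjacencies of [v] to the vertices below [z],
   the smallest vertex giving the most significant digit. *)
Lemma binary_value_set : exists W, forall v s,
  (pair M (pair M 0 v) s ∈ W <-> s = 0) /\
  forall z, pair M (pair M (z + 1) v) s ∈ W <->
    exists s', pair M (pair M z v) s' ∈ W /\
      ((adj v z /\ s = s' + s' + 1) \/ (~ adj v z /\ s = s' + s')).
Proof.
  pose (Step v z s' s := (adj v z /\ s = s' + s' + 1) \/ (~ adj v z /\ s = s' + s')).
  assert (Mono : forall z v s' s, s' < s + 1 ->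
    pair M (pair M z v) s' < pair M (pair M (z + 1) v) s).
  { intros z v s' s L. apply pair_lt.
    apply (le_lt_trans _ (pair M z v + s)).
    - apply le_ex in L. destruct L as [c ->]. apply le_ex. exists c. ring.
    - apply lt_add_r, pair_lt, lt_add_r, lt_succ_diag. }
  assert (Le : forall v z s' s, Step v z s' s -> s' < s + 1).
  { intros v z s' s [[_ ->]|[_ ->]]; apply le_ex; [exists (s' + 1)|exists s']; ring. }
  (* The recursion runs along the codes [c] of triples; by [Mono] the triple one level earlier has a
     smaller code. *)
  destruct (course_of_values (fun c w => exists z, z < c + 1 /\ exists v, v < c + 1 /\
    exists s, s < c + 1 /\ c = pair M (pair M z v) s /\
      ((z = 0 /\ s = 0) \/ exists z', z' < z /\ z = z' + 1 /\
        exists s', s' < s + 1 /\ adj w (pair M (pair M z' v) s') /\ Step v z' s' s))) as [W HW].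
  - unfold Step. d1.
  - intros c w w' A.
    split; intros (z & zc & v & vc & s & Hs & -> & H);
      exists z; (split; [easy|]); exists v; (split; [easy|]); exists s;
      (split; [easy|split; [easy|]]); (destruct H as [H|(z' & L & -> & s' & L' & H & K)];
      [now left|right]); exists z'; (split; [easy|split; [easy|]]); exists s';
      (split; [easy|split; [|easy]]); apply (A _ (Mono z' v s' s L')), H.
  - exists W. intros v s.
    assert (K : forall z, pair M (pair M z v) s ∈ W <-> (z = 0 /\ s = 0) \/
      exists z', z' < z /\ z = z' + 1 /\
        exists s', s' < s + 1 /\ pair M (pair M z' v) s' ∈ W /\ Step v z' s' s).
    { intro z. destruct (vertex_code (fun c => c ∈ W) (pair M (pair M z v) s)) as (w & _ & Hw); [d1|].
      rewrite (HW _ w Hw). split.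
      - intros (z1 & _ & v1 & _ & s1 & _ & Eq & H).
        apply pair_inj in Eq as [Eq <-]. apply pair_inj in Eq as [<- <-].
        destruct H as [H|(z' & L & -> & s' & L' & H & K)]; [now left|right].
        exists z'. split; [easy|split; [easy|]]. exists s'. split; [easy|split; [|easy]].
        apply Hw; [now apply Mono|easy].
      - intro H. exists z. split; [exact (le_lt_trans _ _ _ (pair_le1 z v) (pair_le1 _ s))|].
        exists v. split; [exact (le_lt_trans _ _ _ (pair_le2 z v) (pair_le1 _ s))|].
        exists s. split; [apply pair_le2|split; [easy|]].
        destruct H as [H|(z' & L & -> & s' & L' & H & K)]; [now left|right].
        exists z'. split; [easy|split; [easy|]]. exists s'. split; [easy|split; [|easy]].
        apply Hw; [now apply Mono|easy]. }
    split.
    + rewrite K. split; [|now left]. intros [[_ H]|(z' & L & _)]; [easy|now apply nlt0 in L].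
    + intro z. rewrite K. split.
      * intros [[H _]|(z' & _ & Z & s' & _ & H)]; [now apply succ_neq0 in H|].
        apply succ_inj in Z as <-. now exists s'.
      * intros (s' & H & St). right. exists z. split; [apply lt_succ_diag|split; [easy|]].
        exists s'. split; [exact (Le _ _ _ _ St)|easy].
Qed.

(** The lexicographic order at level [n] becomes the order of numbers up to [q], so that extrema can
    be found by the least number principle. *)
Lemma binary_value : exists W,
  let Val z v s := pair M (pair M z v) s ∈ W in
  forall n, (forall v, exists s, Val n v s) /\
    (forall x y s s', Val n x s -> Val n y s' -> (agree n x y -> s = s') /\
      (forall d, d < n -> agree d x y -> ~ adj x d -> adj y d -> s < s')) /\
    exists q, forall v s, Val n v s -> s < q + 1.
Proof.
  destruct binary_value_set as [W HW]. exists W. cbv zeta.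
  assert (Tot : forall n v, exists s, pair M (pair M n v) s ∈ W).
  { intros n v. revert n. apply S1_ind; [s1|exists 0; now apply HW|].
    intros n [s Hs]. destruct (classic (adj v n)) as [A|A].
    - exists (s + s + 1). apply HW. exists s. auto.
    - exists (s + s). apply HW. exists s. auto. }
  assert (Cmp : forall n x y s s', pair M (pair M n x) s ∈ W -> pair M (pair M n y) s' ∈ W ->
    (agree n x y -> s = s') /\
    (forall d, d < n -> agree d x y -> ~ adj x d -> adj y d -> s < s')).
  { intros n x y. revert n.
    apply (P1_ind (fun n => forall s s', pair M (pair M n x) s ∈ W -> pair M (pair M n y) s' ∈ W ->
      (agree n x y -> s = s') /\
      (forall d, d < n -> agree d x y -> ~ adj x d -> adj y d -> s < s'))).
    - apply (S1_ext (fun e => exists s s', pair M (pair M (e 0%nat) x) s ∈ W /\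
        pair M (pair M (e 0%nat) y) s' ∈ W /\ ~ ((agree (e 0%nat) x y -> s = s') /\
        (forall d, d < e 0%nat -> agree d x y -> ~ adj x d -> adj y d -> s < s')))); [|s1].
      intro e. split; [firstorder|]. intro F. apply NNPP. intro G. apply F.
      intros s s' H H'. apply NNPP. intro K. apply G. now exists s, s'.
    - intros s s' H H'. apply HW in H as ->. apply HW in H' as ->.
      split; [easy|]. intros d Hd. now apply nlt0 in Hd.
    - intros n IH s s' H H'. apply HW in H as (t & H & St). apply HW in H' as (t' & H' & St').
      destruct (IH t t' H H') as [Eq Lt].
      (* A strict inequality survives appending any digits, since [t < t'] gives
         [t + t + 1 < t' + t']. *)
      assert (Dbl : t < t' -> s < s').
      { intro L. destruct (lt_ex _ _ L) as [c ->].
        apply succ_le, le_ex.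
        destruct St as [[_ ->]|[_ ->]], St' as [[_ ->]|[_ ->]];
          [exists (c + c + 1)|exists (c + c)|exists (c + c + 1 + 1)|exists (c + c + 1)]; ring. }
      split.
      + intro A. assert (t = t') as <-.
        { apply Eq, (agree_mono _ (n + 1)); [apply lt_le, lt_succ_diag|easy]. }
        specialize (A n (lt_succ_diag n)).
        destruct St as [[B ->]|[B ->]], St' as [[B' ->]|[B' ->]]; tauto.
      + intros d dn A X Y. apply lt_succ in dn. destruct dn as [dn| ->].
        * apply Dbl. now apply (Lt d).
        * rewrite <- (Eq A) in St'. destruct St as [[B ->]|[B ->]], St' as [[B' ->]|[B' ->]];
            try tauto. apply lt_succ_diag. }
  intro n. split; [apply Tot|split; [apply Cmp|]].
  (* All digits of [o] are one, so its value bounds all values at level [n]. *)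
  destruct (vertex_code (fun u => u = u) n) as (o & _ & Ho); [d1|].
  destruct (Tot n o) as [q Hq]. exists q. intros v s Hs.
  destruct (Cmp n v o s q Hs Hq) as [Eq Lt].
  destruct (classic (agree n v o)) as [A|A].
  - rewrite (Eq A). apply lt_succ_diag.
  - apply lt_le. destruct (first_difference n v o A) as (d & dn & Ad & Df).
    apply (Lt d dn Ad); [|now apply Ho]. assert (adj o d) by now apply Ho. tauto.
Qed.

Lemma lexlt_value_lt n x y (s s' : N M) :
  (forall d, d < n -> agree d x y -> ~ adj x d -> adj y d -> s < s') ->
  lexlt x y -> ~ agree n x y -> s < s'.
Proof.
  intros H L A. destruct (lexlt_before n x y L A) as (d & dn & Ad & X & Y). now apply (H d).
Qed.

(** * Lexicographic extrema and the pigeonhole principle *)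

(** An element of greatest value at level [n] is maximal up to agreement below [n]. *)
Lemma lex_max (A : N M -> Prop) n : D1 (fun e => A (e 0%nat)) -> (exists x, A x) ->
  exists x, A x /\ forall y, A y -> lexlt x y -> agree n x y.
Proof.
  intros HA [x0 Ax0]. destruct binary_value as [W HW]. destruct (HW n) as (Tot & Cmp & q & Hq).
  destruct (S1_greatest (fun s => exists x, A x /\ pair M (pair M n x) s ∈ W) q)
    as (s & (x & Ax & Hx) & Mx).
  - s1.
  - intros s (x & _ & Hx). now apply (Hq x).
  - destruct (Tot x0) as [s Hs]. now exists s, x0.
  - exists x. split; [easy|]. intros y Ay L. apply NNPP. intro D.
    destruct (Tot y) as [s' Hs']. apply (proj2 (nlt_le s s') (Mx s' (ex_intro _ y (conj Ay Hs')))).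
    now apply (lexlt_value_lt n x y); [apply Cmp| |].
Qed.

Lemma lex_min (A : N M -> Prop) n : D1 (fun e => A (e 0%nat)) -> (exists x, A x) ->
  exists x, A x /\ forall y, A y -> lexlt y x -> agree n x y.
Proof.
  intros HA [x0 Ax0]. destruct binary_value as [W HW]. destruct (HW n) as (Tot & Cmp & q & Hq).
  destruct (S1_least (fun s => exists x, A x /\ pair M (pair M n x) s ∈ W))
    as (s & (x & Ax & Hx) & Mn).
  - s1.
  - destruct (Tot x0) as [s Hs]. now exists s, x0.
  - exists x. split; [easy|]. intros y Ay L. apply NNPP. intro D.
    destruct (Tot y) as [s' Hs']. apply (Mn s'); [|now exists y].
    apply (lexlt_value_lt n y x); [now apply Cmp|easy|]. intro K. now apply D, agree_sym.
Qed.

(* The set of values of elements below [x] grows strictly along [X]; read as a binary number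
   (again through a vertex code), it would be unbounded. *)
Lemma lex_pigeonhole X n :
  (forall b, exists x, b < x + 1 /\ x ∈ X) ->
  (forall x y, x ∈ X -> y ∈ X -> x < y -> ~ agree n x y) -> False.
Proof.
  intros Inf Sep. destruct binary_value as [W HW]. destruct (HW n) as (Tot & Cmp & q & Hq).
  (* A set of values is a subset of the numbers up to [q], hence a binary number with [q + 1]
     digits, bounded by [q']. *)
  destruct (HW (q + 1)) as (Tot' & Cmp' & q' & Hq').
  pose (Im s x := exists x', x' < x /\ x' ∈ X /\ pair M (pair M n x') s ∈ W).
  assert (K : forall k, exists x v t, (forall s, s < q + 1 -> (adj v s <-> Im s x)) /\
    pair M (pair M (q + 1) v) t ∈ W /\ k < t + 1).
  { apply S1_ind.
    - unfold Im. s1.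
    - destruct (vertex_code (fun s => Im s 0) (q + 1)) as (v & _ & Hv); [unfold Im; d1|].
      destruct (Tot' v) as [t Ht]. exists 0, v, t. split; [easy|split; [easy|apply lt_0_succ]].
    - intros k (x & v & t & Hv & Ht & kt).
      destruct (Inf x) as (x1 & L & X1).
      destruct (vertex_code (fun s => Im s (x1 + 1)) (q + 1)) as (v' & _ & Hv'); [unfold Im; d1|].
      destruct (Tot' v') as [t' Ht']. exists (x1 + 1), v', t'. split; [easy|split; [easy|]].
      apply lt_succ_mono. apply (le_lt_trans _ t); [easy|].
      assert (Sub : forall s, Im s x -> Im s (x1 + 1)).
      { intros s (x' & F & G). exists x'. split; [|easy].
        exact (lt_trans _ _ _ F L). }
      (* The value of [x1] is new: an element of [X] below [x] with the same value would agree with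
         [x1] below [n]. *)
      assert (D : ~ agree (q + 1) v v').
      { intro A. destruct (Tot x1) as [s Hs]. assert (sq := Hq _ _ Hs).
        assert (F : Im s x).
        { apply Hv, A, Hv'; [easy..|]. exists x1. split; [apply lt_succ_diag|easy]. }
        destruct F as (x' & x'x & X' & F).
        apply (Sep x' x1 X' X1); [exact (lt_le_trans _ _ _ x'x L)|].
        destruct (Cmp x' x1 s s F Hs) as [_ C1]. destruct (Cmp x1 x' s s Hs F) as [_ C2].
        apply NNPP. intro N1. assert (N2 : ~ agree n x1 x') by (intro; now apply N1, agree_sym).
        destruct (disagree_lexlt _ _ _ N1) as [G|G].
        - apply (lt_irrefl s), (lexlt_value_lt n x' x1); easy.
        - apply (lt_irrefl s), (lexlt_value_lt n x1 x'); easy. }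
      (* Digits only change from zero to one, so the first change makes the number larger. *)
      destruct (first_difference _ _ _ D) as (d & dq & Ad & Df).
      apply (proj2 (Cmp' v v' t t' Ht Ht') d dq Ad);
        rewrite (Hv d dq), (Hv' d dq) in *; specialize (Sub d); tauto. }
  destruct (K (q' + 1)) as (x & v & t & _ & Ht & L). apply Hq' in Ht.
  apply (lt_irrefl (q' + 1)). exact (lt_le_trans _ _ _ (lt_le_trans _ _ _ L
    (lt_succ_mono _ _ Ht)) (lt_succ_diag _)).
Qed.

(** * Copies of the Rado graph *)

Lemma D1_collection (R : N M -> N M -> Prop) b : D1 (fun e => R (e 0%nat) (e 1%nat)) ->
  (forall x, x < b -> exists y, R x y) -> exists c, forall x, x < b -> exists y, y < c /\ R x y.
Proof.
  intros HR H.
  assert (K : forall n, exists c, forall x, x < n -> x < b -> exists y, y < c /\ R x y).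
  { apply S1_ind; [s1| |].
    - exists 0. intros x Hx. now apply nlt0 in Hx.
    - intros n [c Hc]. destruct (classic (n < b)) as [L|L].
      + destruct (H n L) as [y Hy]. destruct (common_bound y c) as (d & yd & cd). exists d.
        intros x xn xb. apply lt_succ in xn. destruct xn as [xn| ->]; [|now exists y].
        destruct (Hc x xn xb) as (y' & y'c & Hy'). exists y'. split; [|easy].
        now apply (lt_trans _ c).
      + exists c. intros x xn xb. apply lt_succ in xn. destruct xn as [xn| ->]; [auto|easy]. }
  destruct (K b) as [c Hc]. exists c. auto.
Qed.

Definition unbounded (X : S M) : Prop := forall b, exists x, b < x + 1 /\ x ∈ X.

(** The Rado property inside [V], with an arbitrarily large solution; it is all that is kept of a
    copy. *)
Definition extendible (V : S M) : Prop :=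
  forall (P : N M -> Prop) b, D1 (fun e => P (e 0%nat)) ->
  exists y, b < y + 1 /\ y ∈ V /\ forall u, u < b -> u ∈ V -> (adj y u <-> P u).

(** The prescription is pulled back along the isomorphism, met by a vertex [v] of the whole graph,
    and carried to the image of [v]. Collection supplies a [c] beyond the preimages of the elements
    of [V] below [b]. *)
Lemma iso_extendible V H : iso_onto_induced M E V H -> extendible V.
Proof.
  intros (Fun & Ran & Inj & Onto & Pres) P b HP.
  destruct (D1_collection (fun w v => w ∈ V -> pair M v w ∈ H) b) as [c Hc]; [d1| |].
  { intros w _. destruct (classic (w ∈ V)) as [L|L]; [|now exists 0].
    destruct (Onto w L) as [v Hv]. now exists v. }
  destruct (vertex_code (fun v => exists w, w < b /\ pair M v w ∈ H /\ P w) c) as (v & cv & Hv); [d1|].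
  destruct (Fun v) as (w & Hw & _). exists w. split; [|split; [now apply (Ran v)|]].
  (* If the image were below [b], its preimage [v] would be below [c]. *)
  - apply nlt_le. intro wb. destruct (Hc w wb) as (v' & v'c & Hv').
    specialize (Hv' (Ran _ _ Hw)). rewrite (Inj _ _ _ Hv' Hw) in v'c.
    now apply nlt_le in cv.
  - intros u ub uV. destruct (Hc u ub) as (v' & v'c & Hv'). specialize (Hv' uV).
    rewrite <- (Pres _ _ _ _ Hw Hv'), (Hv v' v'c). split.
    + intros (u' & _ & Hu' & Pu'). destruct (Fun v') as (u'' & _ & Un).
      now rewrite (Un u Hv'), <- (Un u' Hu').
    + intro Pu. now exists u.
Qed.

Lemma extendible_two V : extendible V -> exists x y, x ∈ V /\ y ∈ V /\ x < y.
Proof.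
  intro HV. destruct (HV (fun u => u = u) 0) as (x & _ & Hx & _); [d1|].
  destruct (HV (fun u => u = u) (x + 1)) as (y & L & Hy & _); [d1|].
  exists x, y. split; [easy|split; [easy|]]. now apply succ_le.
Qed.

(** This admits a truth value of the metatheory as a parameter of a definition. *)
Lemma D1_prop (p : Prop) : D1 (fun _ => p).
Proof.
  destruct (classic p) as [H|H].
  - apply (D1_ext (fun _ => 0 = 0)); [easy|d1].
  - apply (D1_ext (fun _ => 0 <> 0)); [easy|d1].
Qed.

Lemma extendible_adj2 V b x y (p q : Prop) : extendible V -> x ∈ V -> y ∈ V -> x <> y ->
  exists z, b < z /\ x < z /\ y < z /\ z ∈ V /\ (adj z x <-> p) /\ (adj z y <-> q).
Proof.
  intros HV Hx Hy D. destruct (common_bound x y) as (c & xc & yc).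
  destruct (common_bound b c) as (d & bd & cd).
  destruct (HV (fun u => (u = x /\ p) \/ (u = y /\ q)) d) as (z & dz & Hz & K).
  { apply D1_or; apply D1_and; try d1; apply D1_prop. }
  assert (xd := lt_trans _ _ _ xc cd). assert (yd := lt_trans _ _ _ yc cd).
  exists z. repeat (split; [now apply (lt_le_trans _ d)|]).
  split; [easy|]. split; rewrite K; try easy; intuition congruence.
Qed.

(* A lexicographic extremum [x] of [V] at a level beyond two vertices of [V] has neighbours
   (and non-neighbours) in [V] that leave its class at that level, all in one direction. *)
Lemma extendible_types V (p : Prop) : extendible V ->
  (exists x y, x ∈ V /\ y ∈ V /\ x < y /\ (adj x y <-> p) /\ lexlt x y) /\
  (exists x y, x ∈ V /\ y ∈ V /\ x < y /\ (adj x y <-> p) /\ lexlt y x).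
Proof.
  intro HV. destruct (extendible_two V HV) as (w1 & w2 & V1 & V2 & L).
  destruct (common_bound w1 w2) as (n & n1 & n2).
  assert (Leave : forall x, x ∈ V -> exists y, x < y /\ y ∈ V /\ (adj x y <-> p) /\ ~ agree n x y).
  { intros x Hx.
    assert (W : exists w, w ∈ V /\ w < n /\ x <> w).
    { destruct (classic (x = w1)) as [->|D]; [|now exists w1]. exists w2. split; [easy|].
      split; [easy|]. intros ->. now apply lt_irrefl in L. }
    destruct W as (w & Hw & wn & D).
    (* Reversing the adjacency of [x] to [w] puts [y] outside the class of [x], independently of
       [p]. *)
    destruct (extendible_adj2 V 0 x w p (~ adj x w) HV Hx Hw D) as (y & _ & xy & _ & Hy & P1 & P2).
    exists y. split; [easy|split; [easy|split]].
    - rewrite <- P1. split; apply adj_sym.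
    - intro A. specialize (A w wn). tauto. }
  split.
  - destruct (lex_min (fun x => x ∈ V) n) as (x & Hx & Mn); [d1|now exists w1|].
    destruct (Leave x Hx) as (y & xy & Hy & P1 & D). exists x, y. repeat (split; [easy|]).
    destruct (disagree_lexlt _ _ _ D) as [|K]; [easy|]. now apply Mn in K.
  - destruct (lex_max (fun x => x ∈ V) n) as (x & Hx & Mx); [d1|now exists w1|].
    destruct (Leave x Hx) as (y & xy & Hy & P1 & D). exists x, y. repeat (split; [easy|]).
    destruct (disagree_lexlt _ _ _ D) as [K|]; [|easy]. now apply Mx in K.
Qed.

(** * Eight colors from three truth values *)

Lemma numeral_inj i j : numeral M i = numeral M j -> i = j.
Proof.
  revert j. induction i as [|i IH]; intros [|j] H; cbn in H.
  - easy.
  - symmetry in H. now apply succ_neq0 in H.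
  - now apply succ_neq0 in H.
  - apply succ_inj in H. f_equal. auto.
Qed.

Lemma numeral_lt i k : (i < k)%nat -> numeral M i < numeral M k.
Proof.
  induction 1 as [|k _ IH]; cbn; [apply lt_succ_diag|now apply lt_le].
Qed.

Definition has (b : bool) (P : Prop) : Prop := if b then P else ~ P.

Lemma has_ex P : exists b, has b P.
Proof. destruct (classic P); [now exists true|now exists false]. Qed.

Lemma has_unique b b' P : has b P -> has b' P -> b = b'.
Proof. destruct b, b'; cbn; tauto. Qed.

Definition color8 (a b c : bool) : nat :=
  ((if a then 4 else 0) + (if b then 2 else 0) + (if c then 1 else 0))%nat.

Lemma color8_lt a b c : (color8 a b c < 8)%nat.
Proof. destruct a, b, c; cbn; lia. Qed.

Lemma extendible_has_type V a l : extendible V ->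
  exists x y, x ∈ V /\ y ∈ V /\ x < y /\ has a (adj x y) /\ has l (lexlt x y).
Proof.
  intro HV. destruct (extendible_types V (a = true) HV) as [T1 T2].
  assert (A : forall x y, (adj x y <-> a = true) -> has a (adj x y)).
  { intros x y K. destruct a; cbn; [now apply K|now rewrite K]. }
  destruct l.
  - destruct T1 as (x & y & Hx & Hy & xy & K & L). exists x, y. now auto 6.
  - destruct T2 as (x & y & Hx & Hy & xy & K & L). exists x, y. apply lexlt_asym in L. now auto 6.
Qed.

Lemma has_iff b P Q : has b P -> has b Q -> (P <-> Q).
Proof. destruct b; cbn; tauto. Qed.

(** One color for each of the three other types and two for the type [a], [b] make five distinct
    colors. *)
Lemma color8_four_types (cs : list (N M)) (a b : bool) :
  (forall a b, exists c, In (numeral M (color8 a b c)) cs) ->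
  In (numeral M (color8 a b true)) cs -> In (numeral M (color8 a b false)) cs ->
  (4 < length cs)%nat.
Proof.
  intros H T F.
  destruct (H a (negb b)) as [c1 H1], (H (negb a) b) as [c2 H2], (H (negb a) (negb b)) as [c3 H3].
  apply (NoDup_incl_length (l := map (numeral M) (color8 a b true :: color8 a b false ::
    color8 a (negb b) c1 :: color8 (negb a) b c2 :: color8 (negb a) (negb b) c3 :: nil))).
  - apply FinFun.Injective_map_NoDup; [intros i j; apply numeral_inj|].
    destruct a, b, c1, c2, c3; repeat constructor; cbn; intuition discriminate.
  - intros x. cbn. intuition congruence.
Qed.

Lemma D1_ex_bool (P : bool -> env -> Prop) : (forall b, D1 (P b)) ->
  D1 (fun e => exists b, P b e).
Proof.
  intro H. apply (D1_ext (fun e => P true e \/ P false e)); [|now apply D1_or].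
  intro e. split; [intros [K|K]; eauto|]. intros [[|] K]; auto.
Qed.

Lemma D1_has b P : D1 P -> D1 (fun e => has b (P e)).
Proof. destruct b; [easy|apply D1_not]. Qed.

(** * Stable colorings *)

Hypothesis HRG : RG2 M E 8 4.

(** If [f] took both values on one type of pairs, the copy would show five colors, since all four
    types occur. *)
Lemma color_by_type (f : N M -> N M -> Prop) : D1 (fun e => f (e 0%nat) (e 1%nat)) ->
  exists V, extendible V /\ forall x y x' y', x ∈ V -> y ∈ V -> x < y -> x' ∈ V -> y' ∈ V -> x' < y' ->
    (adj x y <-> adj x' y') -> (lexlt x y <-> lexlt x' y') -> f x y -> f x' y'.
Proof.
  intro Hf.
  pose (Col x y c := exists a1 a2 a3, has a1 (adj x y) /\ has a2 (lexlt x y) /\ has a3 (f x y) /\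
    c = numeral M (color8 a1 a2 a3)).
  destruct (D1_comprehension (fun t => exists x, x < t + 1 /\ exists y, y < t + 1 /\
    exists c, c < t + 1 /\ t = pair M (pair M x y) c /\ Col x y c)) as [F HF].
  { apply (D1_bex (fun e => e 0%nat + 1)); [tm|]. apply (D1_bex (fun e => tl e 0%nat + 1)); [tm|].
    apply (D1_bex (fun e => tl (tl e) 0%nat + 1)); [tm|]. apply D1_and; [d1|].
    unfold Col. apply D1_ex_bool; intro a1. apply D1_ex_bool; intro a2. apply D1_ex_bool; intro a3.
    repeat apply D1_and; try apply D1_has; d1. }
  assert (HF' : forall x y c, fval M F x y c <-> Col x y c).
  { intros x y c. unfold fval. rewrite HF. split.
    - intros (x' & _ & y' & _ & c' & _ & Eq & K).
      apply pair_inj in Eq as [Eq <-]. now apply pair_inj in Eq as [<- <-].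
    - intro K. exists x. split; [exact (le_lt_trans _ _ _ (pair_le1 x y) (pair_le1 _ c))|].
      exists y. split; [exact (le_lt_trans _ _ _ (pair_le2 x y) (pair_le1 _ c))|].
      exists c. split; [apply pair_le2|easy]. }
  assert (Un : forall x y c a1 a2 a3, Col x y c -> has a1 (adj x y) -> has a2 (lexlt x y) ->
    has a3 (f x y) -> c = numeral M (color8 a1 a2 a3)).
  { intros x y c a1 a2 a3 (b1 & b2 & b3 & B1 & B2 & B3 & ->) A1 A2 A3.
    now rewrite (has_unique _ _ _ A1 B1), (has_unique _ _ _ A2 B2), (has_unique _ _ _ A3 B3). }
  destruct (HRG F) as (V & [H Iso] & cs & Len & Hcs).
  { intros x y _. destruct (has_ex (adj x y)) as [a1 A1], (has_ex (lexlt x y)) as [a2 A2],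
      (has_ex (f x y)) as [a3 A3].
    exists (numeral M (color8 a1 a2 a3)). split; [apply numeral_lt, color8_lt|].
    split; [apply HF'; now exists a1, a2, a3|].
    intros c' Hc'. apply HF' in Hc'. now apply (Un x y). }
  assert (HV := iso_extendible V H Iso). exists V. split; [easy|].
  assert (In3 : forall x y a1 a2 a3, x ∈ V -> y ∈ V -> x < y ->
    has a1 (adj x y) -> has a2 (lexlt x y) -> has a3 (f x y) -> In (numeral M (color8 a1 a2 a3)) cs).
  { intros x y a1 a2 a3 Hx Hy xy A1 A2 A3. destruct (Hcs x y Hx Hy xy) as (c & Hc & K).
    apply HF' in K. now rewrite <- (Un x y c a1 a2 a3). }
  intros x y x' y' Hx Hy xy Hx' Hy' xy' Eq1 Eq2 Fxy. apply NNPP. intro Fxy'.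
  apply (Nat.lt_irrefl 4), (fun K => Nat.lt_le_trans _ _ _ K Len).
  destruct (has_ex (adj x y)) as [a1 A1], (has_ex (lexlt x y)) as [a2 A2].
  apply (color8_four_types cs a1 a2).
  - intros b1 b2. destruct (extendible_has_type V b1 b2 HV) as (u & v & Hu & Hv & uv & K1 & K2). destruct (has_ex (f u v)) as [b3 K3].
    exists b3. now apply (In3 u v).
  - now apply (In3 x y).
  - apply (In3 x' y'); try easy; [destruct a1|destruct a2]; cbn in *; tauto.
Qed.

Definition stable_rel (f : N M -> N M -> Prop) : Prop :=
  forall x, (exists n, forall y, n < y -> f x y) \/ (exists n, forall y, n < y -> ~ f x y).

Definition homogeneous (f : N M -> N M -> Prop) (X : S M) : Prop :=
  (forall x y, x ∈ X -> y ∈ X -> x < y -> f x y) \/ (forall x y, x ∈ X -> y ∈ X -> x < y -> ~ f x y).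

(** The greedy set never gets stuck, because the constant prescription [p] on its earlier elements
    can be met. *)
Lemma extendible_clique V (p : Prop) : extendible V -> exists X, unbounded X /\
  (forall x, x ∈ X -> x ∈ V) /\ forall x y, x ∈ X -> y ∈ X -> x < y -> (adj x y <-> p).
Proof.
  intro HV. destruct (greedy_set (fun x => x ∈ V) (fun x y => adj x y <-> p)) as (X & XV & HX & Un).
  { d1. } { apply D1_iff; [d1|apply D1_prop]. }
  exists X. split; [|now split]. refine (Un _). intro b.
  destruct (HV (fun _ => p) b (D1_prop p)) as (y & yb & Hy & K).
  exists y. split; [easy|split; [easy|]]. intros u ub uX. rewrite <- (K u ub (XV u uX)).
  split; apply adj_sym.
Qed.

Lemma stable_dichotomy (f : N M -> N M -> Prop) :
  D1 (fun e => f (e 0%nat) (e 1%nat)) -> stable_rel f ->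
  (exists X, unbounded X /\ homogeneous f X) \/
  (exists V, extendible V /\
    ((forall x y, x ∈ V -> y ∈ V -> x < y -> (f x y <-> lexlt x y)) \/
     (forall x y, x ∈ V -> y ∈ V -> x < y -> (f x y <-> lexlt y x)))).
Proof.
  intros Hf St. destruct (color_by_type f Hf) as (V & HV & C).
  assert (Lex : forall x y, x < y -> (lexlt y x <-> ~ lexlt x y)).
  { intros x y xy. split; [apply lexlt_asym|]. intro K.
    destruct (lexlt_total x y) as [|]; try easy. intros ->. now apply lt_irrefl in xy. }
  (* [h a l] is the value of [f] on pairs of adjacency [a] and orientation [l], read off from one
     such pair. *)
  assert (H : exists h : bool -> bool -> bool, forall x y a l, x ∈ V -> y ∈ V -> x < y ->
    has a (adj x y) -> has l (lexlt x y) -> has (h a l) (f x y)).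
  { assert (H1 : forall a l, exists b, forall x y, x ∈ V -> y ∈ V -> x < y ->
      has a (adj x y) -> has l (lexlt x y) -> has b (f x y)).
    { intros a l. destruct (extendible_has_type V a l HV) as (u & v & Hu & Hv & uv & A & L).
      destruct (has_ex (f u v)) as [b B]. exists b. intros x y Hx Hy xy A' L'.
      assert (E1 := has_iff _ _ _ A A'). assert (E2 := has_iff _ _ _ L L').
      assert (E3 : f u v <-> f x y) by (split; apply C; easy).
      destruct b; cbn in *; tauto. }
    destruct (H1 true true) as [h1 K1], (H1 true false) as [h2 K2], (H1 false true) as [h3 K3],
      (H1 false false) as [h4 K4].
    exists (fun a l : bool => if a then if l then h1 else h2 else if l then h3 else h4).
    intros x y [|] [|]; auto. }
  destruct H as [h H]. clear C.
  assert (Cl : forall a, h a true = h a false -> exists X, unbounded X /\ homogeneous f X).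
  { intros a Eq. destruct (extendible_clique V (a = true) HV) as (X & Un & XV & HX).
    exists X. split; [easy|].
    assert (K : forall x y, x ∈ X -> y ∈ X -> x < y -> has (h a true) (f x y)).
    { intros x y Hx Hy xy. destruct (has_ex (lexlt x y)) as [l L].
      replace (h a true) with (h a l) by now destruct l.
      apply H; auto. specialize (HX x y Hx Hy xy). destruct a; cbn; [now apply HX|now rewrite HX]. }
    destruct (h a true); [now left|now right]. }
  destruct (Bool.bool_dec (h true true) (h true false)) as [D1'|D1']; [left; now apply (Cl true)|].
  destruct (Bool.bool_dec (h false true) (h false false)) as [D2'|D2']; [left; now apply (Cl false)|].
  right. exists V. split; [easy|]. clear Cl.
  (* For either adjacency the value now changes with the orientation, so [h] is the orientation up
     to a correction [t]. A constant [t] leaves the two cases of the conclusion. *)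
  assert (Hx : exists t : bool -> bool, forall a l, h a l = xorb l (t a)).
  { exists (fun a => h a false). intros [|] [|]; cbn; try easy.
    - destruct (h true true), (h true false); easy.
    - destruct (h false true), (h false false); easy. }
  destruct Hx as [t Ht].
  destruct (Bool.bool_dec (t true) (t false)) as [Eq|Ne].
  { assert (K : forall x y, x ∈ V -> y ∈ V -> x < y -> exists l, has l (lexlt x y) /\
      has (xorb l (t true)) (f x y)).
    { intros x y Hx Hy xy. destruct (has_ex (adj x y)) as [a A], (has_ex (lexlt x y)) as [l L].
      exists l. split; [easy|]. replace (t true) with (t a) by (destruct a; congruence).
      rewrite <- Ht. now apply H. }
    destruct (t true); [right|left]; intros x y Hx Hy xy; rewrite ?Lex by easy;
      destruct (K x y Hx Hy xy) as [[|] [L F]]; cbn in *; tauto. }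
  (* Now the limit of [f] at [x] ties adjacency to [x] to the side of [x], contradicting that
     adjacencies to two vertices can be prescribed independently. *)
  exfalso.
  (* With [g] the limit of [f] at [x], the adjacency [a] is chosen with [t a = xorb l g]; far
     vertices of this adjacency then have orientation [l]. *)
  assert (Side : forall x l, x ∈ V -> exists n a, forall y, y ∈ V -> n < y -> x < y ->
    has a (adj x y) -> has l (lexlt x y)).
  { intros x l Hx.
    assert (G : exists n g, forall y, n < y -> has g (f x y)).
    { destruct (St x) as [[n Hn]|[n Hn]]; exists n; [now exists true|now exists false]. }
    destruct G as (n & g & G). exists n.
    assert (Ha : exists a, t a = xorb l g).
    { destruct (Bool.bool_dec (t true) (xorb l g)) as [Q|Q]; [now exists true|exists false].
      destruct (t true), (t false), (xorb l g); easy. }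
    destruct Ha as [a Ha]. exists a. intros y Hy ny xy A.
    destruct (has_ex (lexlt x y)) as [l' L].
    assert (F := H x y a l' Hx Hy xy A L). rewrite Ht, Ha in F.
    assert (Q := has_unique _ _ _ F (G y ny)).
    replace l with l'; [easy|]. destruct l, l', g; easy. }
  (* With [a] below [b], some far [z] is forced to lie above [b] but not above [a]. *)
  destruct (extendible_types V True HV) as [(a & b & Va & Vb & ab & _ & L) _].
  destruct (Side a false Va) as (n & p & Hn), (Side b true Vb) as (m & q & Hm).
  destruct (common_bound n m) as (d & nd & md).
  destruct (extendible_adj2 V d a b (p = true) (q = true) HV Va Vb)
    as (z & dz & az & bz & Vz & Ka & Kb).
  { intros ->. now apply lt_irrefl in ab. }
  assert (Z1 := Hn z Vz (lt_trans _ _ _ nd dz) az).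
  assert (Z2 := Hm z Vz (lt_trans _ _ _ md dz) bz).
  assert (Sym : forall u c, (adj z u <-> c = true) -> has c (adj u z)).
  { intros u c K. destruct c; cbn; [now apply adj_sym, K|].
    intro A. apply adj_sym, K in A. easy. }
  apply Z1; [now apply Sym|]. apply (lexlt_trans _ _ _ L), Z2. now apply Sym.
Qed.

(* Otherwise "lying in the same class" (transported from [P] to all numbers) is a stable coloring
   with limit false, whose homogeneous sets are refuted by the pigeonhole principle. *)
Lemma infinite_class P n : unbounded P ->
  exists x, x ∈ P /\ forall b, exists y, b < y + 1 /\ y ∈ P /\ agree n x y.
Proof.
  intro Inf. apply NNPP. intro F.
  assert (Fin : forall x, x ∈ P -> exists b, forall y, y ∈ P -> b < y + 1 -> ~ agree n x y).
  { intros x Hx. apply NNPP. intro G. apply F. exists x. split; [easy|]. intro b.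
    apply NNPP. intro K. apply G. exists b. intros y Hy L A. apply K. now exists y. }
  clear F.
  (* The first element of [P] from [x] on represents [x]. *)
  pose (nxt x p := x < p + 1 /\ p ∈ P /\ forall q, q < p -> x < q + 1 -> ~ q ∈ P).
  assert (Ex : forall x, exists p, nxt x p).
  { intro x. destruct (S1_least (fun p => x < p + 1 /\ p ∈ P)) as (p & [xp Pp] & L); [s1|apply Inf|].
    exists p. split; [easy|split; [easy|]]. intros q qp xq Pq. now apply (L q qp). }
  assert (Un : forall x p q, nxt x p -> nxt x q -> p = q).
  { intros x p q (p1 & p2 & p3) (q1 & q2 & q3).
    destruct (lt_total p q) as [L|[L|L]]; [|easy|]; exfalso; [now apply (q3 p)|now apply (p3 q)]. }
  pose (f x y := exists p, nxt x p /\ exists q, nxt y q /\ agree n p q).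
  assert (f_iff : forall x y p q, nxt x p -> nxt y q -> (f x y <-> agree n p q)).
  { intros x y p q Hp Hq. split; [|intro A; exists p; split; [easy|]; now exists q].
    intros (p' & Hp' & q' & Hq' & A). now rewrite (Un x p p'), (Un y q q'). }
  assert (Hf : D1 (fun e => f (e 0%nat) (e 1%nat))).
  { split; [unfold f, nxt; s1|].
    apply (S1_ext (fun e => exists p, nxt (e 0%nat) p /\ exists q, nxt (e 1%nat) q /\ ~ agree n p q));
      [|unfold nxt; s1].
    intro e. destruct (Ex (e 0%nat)) as [p Hp], (Ex (e 1%nat)) as [q Hq].
    rewrite (f_iff _ _ p q Hp Hq). split.
    - intros (p' & Hp' & q' & Hq' & A). now rewrite (Un _ p p' Hp Hp'), (Un _ q q' Hq Hq').
    - intro A. exists p. split; [easy|]. now exists q. }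
  assert (Lim : forall x, exists m, forall y, m < y -> ~ f x y).
  { intro x. destruct (Ex x) as [p Hp]. destruct (Fin p) as [b Hb]; [apply Hp|].
    exists b. intros y by_. destruct (Ex y) as [q Hq]. rewrite (f_iff _ _ p q Hp Hq).
    apply Hb; [apply Hq|]. apply (lt_trans _ _ _ by_), Hq. }
  (* The representatives of such an [X] would be unboundedly many elements of pairwise different
     classes. *)
  assert (Sep : forall X, unbounded X -> ~ forall x y, x ∈ X -> y ∈ X -> x < y -> ~ f x y).
  { intros X HX HS.
    destruct (D1_comprehension (fun p => exists x, x < p + 1 /\ x ∈ X /\ nxt x p)) as [Y HY];
      [unfold nxt; d1|].
    apply (lex_pigeonhole Y n).
    - intro b. destruct (HX b) as (x & bx & Xx). destruct (Ex x) as [p Hp]. exists p. split.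
      + exact (lt_le_trans _ _ _ bx (lt_succ_mono _ _ (proj1 Hp))).
      + apply HY. exists x. split; [apply Hp|easy].
    - intros p q Hp Hq pq A. apply HY in Hp as (x & _ & Xx & Hp). apply HY in Hq as (y & _ & Xy & Hq).
      destruct (lt_total x y) as [L|[->|L]].
      + apply (HS x y Xx Xy L). now apply (f_iff _ _ p q).
      + rewrite (Un y p q Hp Hq) in pq. now apply lt_irrefl in pq.
      + apply (HS y x Xy Xx L). apply (f_iff _ _ q p); try easy. now apply agree_sym. }
  (* By [Lim] every element of [V] has [R]-successors arbitrarily far out, so a chain for [R] is
     unbounded, against [Sep]. *)
  assert (Chain : forall V R, extendible V -> D1 (fun e => R (e 0%nat) (e 1%nat)) ->
    (forall x y z, R x y -> R y z -> R x z) ->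
    (forall x y, x ∈ V -> y ∈ V -> x < y -> (~ f x y <-> R x y)) -> False).
  { intros V R HV HR Tr HfR.
    assert (VU : forall b, exists x, b < x + 1 /\ x ∈ V).
    { intro b. destruct (HV (fun u => u = u) b) as (y & by_ & Hy & _); [d1|]. now exists y. }
    destruct (chain_set (fun x => x ∈ V) R) as (X & XV & HX & XU); try easy; [d1| |].
    - intros x b Hx. destruct (Lim x) as [m Hm].
      destruct (common_bound m x) as (c & mc & xc), (common_bound b c) as (d & bd & cd).
      destruct (VU d) as (y & dy & Hy). exists y. split; [exact (lt_trans _ _ _ bd dy)|split; [easy|]].
      assert (cy := lt_le_trans _ _ _ cd dy).
      apply HfR; [easy|easy|exact (lt_trans _ _ _ xc cy)|]. apply Hm. exact (lt_trans _ _ _ mc cy).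
    - apply (Sep X XU). intros x y Hx Hy xy. apply HfR; auto. }
  assert (Lex : forall x y, x < y -> (~ lexlt x y <-> lexlt y x) /\ (~ lexlt y x <-> lexlt x y)).
  { intros x y xy. assert (D : x <> y) by (intros ->; now apply lt_irrefl in xy).
    generalize (lexlt_total x y D) (lexlt_asym x y). tauto. }
  destruct (stable_dichotomy f Hf) as [(X & XU & [HX|HX])|(V & HV & [K|K])].
  - intro x. right. apply Lim.
  - destruct (XU 0) as (x & _ & Xx). destruct (Lim x) as [m Hm].
    destruct (common_bound m x) as (c & mc & xc). destruct (XU c) as (y & cy & Xy).
    apply (Hm y); [exact (lt_le_trans _ _ _ mc cy)|].
    apply HX; [easy|easy|exact (lt_le_trans _ _ _ xc cy)].
  - exact (Sep X XU HX).
  - apply (Chain V (fun x y => lexlt y x) HV); [d1| |].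
    + intros x y z H1 H2. exact (lexlt_trans _ _ _ H2 H1).
    + intros x y Hx Hy xy. rewrite (K x y Hx Hy xy). exact (proj1 (Lex x y xy)).
  - apply (Chain V lexlt HV); [d1|exact lexlt_trans|].
    intros x y Hx Hy xy. rewrite (K x y Hx Hy xy). exact (proj2 (Lex x y xy)).
Qed.

(** Every tournament on three vertices contains a directed path through all of them. *)
Lemma middle_of_three n (a b c : N M) : ~ agree n a b -> ~ agree n b c -> ~ agree n a c ->
  exists x y z, lexlt x y /\ lexlt y z /\ ~ agree n x y /\ ~ agree n y z /\
    (x = a \/ x = b \/ x = c) /\ (y = a \/ y = b \/ y = c) /\ (z = a \/ z = b \/ z = c).
Proof.
  intros ab bc ac.
  assert (ba : ~ agree n b a) by (intro; now apply ab, agree_sym).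
  assert (cb : ~ agree n c b) by (intro; now apply bc, agree_sym).
  assert (ca : ~ agree n c a) by (intro; now apply ac, agree_sym).
  destruct (disagree_lexlt n a b ab) as [L1|L1], (disagree_lexlt n b c bc) as [L2|L2],
    (disagree_lexlt n a c ac) as [L3|L3];
  first [ now (exists a, b, c; auto 12) | now (exists a, c, b; auto 12) | now (exists b, a, c; auto 12)
        | now (exists b, c, a; auto 12) | now (exists c, a, b; auto 12) | now (exists c, b, a; auto 12) ].
Qed.

Lemma stable_homogeneous (f : N M -> N M -> Prop) :
  D1 (fun e => f (e 0%nat) (e 1%nat)) -> stable_rel f -> exists X, unbounded X /\ homogeneous f X.
Proof.
  intros Hf St. destruct (stable_dichotomy f Hf St) as [H|(V & HV & K)]; [easy|exfalso].
  destruct (extendible_two V HV) as (w1 & w2 & V1 & V2 & L).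
  assert (D : w1 <> w2) by (intros ->; now apply lt_irrefl in L).
  (* At this level, vertices with different adjacencies to [w1] or [w2] fall into different
     classes. *)
  destruct (common_bound w1 w2) as (n & n1 & n2).
  assert (Cls : forall p q : Prop, exists x, x ∈ V /\ (adj x w1 <-> p) /\ (adj x w2 <-> q) /\
    forall b, exists y, b < y /\ y ∈ V /\ agree n x y).
  { intros p q.
    destruct (D1_comprehension (fun y => y ∈ V /\ (adj y w1 <-> p) /\ (adj y w2 <-> q))) as [P HP].
    { apply D1_and; [d1|apply D1_and; (apply D1_iff; [d1|apply D1_prop])]. }
    destruct (infinite_class P n) as (x & Px & Hx).
    - intro b. destruct (extendible_adj2 V b w1 w2 p q HV V1 V2 D) as (y & by_ & _ & _ & Hy & A).
      exists y. split; [now apply lt_le|now apply HP].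
    - apply HP in Px. exists x. do 3 (split; [apply Px|]). intro b.
      destruct (Hx (b + 1)) as (y & by_ & Py & A). exists y. split; [now apply succ_le|].
      split; [now apply HP in Py|easy]. }
  (* Three of the four adjacency patterns give three classes, each meeting [V] in an infinite
     set. *)
  destruct (Cls True True) as (a & Va & a1 & a2 & Ha), (Cls True False) as (b & Vb & b1 & b2 & Hb),
    (Cls False False) as (c & Vc & c1 & c2 & Hc).
  destruct (middle_of_three n a b c) as (x & y & z & xy & yz & Dxy & Dyz & Cx & Cy & Cz).
  { intro A. specialize (A w2 n2). tauto. }
  { intro A. specialize (A w1 n1). tauto. }
  { intro A. specialize (A w1 n1). tauto. }
  assert (Vy : y ∈ V) by (now destruct Cy as [->|[->| ->]]).
  assert (Hx : forall b, exists u, b < u /\ u ∈ V /\ agree n x u) by (now destruct Cx as [->|[->| ->]]).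
  assert (Hz : forall b, exists u, b < u /\ u ∈ V /\ agree n z u) by (now destruct Cz as [->|[->| ->]]).
  assert (Below : forall d, exists u, d < u /\ y < u /\ u ∈ V /\ lexlt u y).
  { intro d. destruct (common_bound d y) as (e & de & ye). destruct (Hx e) as (u & eu & Vu & A).
    exists u. split; [exact (lt_trans _ _ _ de eu)|]. split; [exact (lt_trans _ _ _ ye eu)|].
    split; [easy|]. exact (lexlt_agree n x u y y A (agree_refl n y) Dxy xy). }
  assert (Above : forall d, exists u, d < u /\ y < u /\ u ∈ V /\ lexlt y u).
  { intro d. destruct (common_bound d y) as (e & de & ye). destruct (Hz e) as (u & eu & Vu & A).
    exists u. split; [exact (lt_trans _ _ _ de eu)|]. split; [exact (lt_trans _ _ _ ye eu)|].
    split; [easy|]. exact (lexlt_agree n y y z u (agree_refl n y) A Dyz yz). }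
  (* Beyond any [m] there are elements of [V] on both sides of [y], so the relation has no limit at
     [y]. *)
  destruct (St y) as [[m Hm]|[m Hm]];
    destruct (Below m) as (u & mu & yu & Vu & Lu), (Above m) as (v & mv & yv & Vv & Lv);
    assert (Fu := Hm u mu); assert (Fv := Hm v mv);
    apply lexlt_asym in Lu as Nu; apply lexlt_asym in Lv as Nv;
    destruct K as [K|K]; rewrite (K y u) in Fu by easy; rewrite (K y v) in Fv by easy; tauto.
Qed.

(** The coloring is read as the relation of having color 0, whose negation on pairs [x < y] is color
    1. *)
Lemma stable_ramsey : SRT22 M.
Proof.
  intros F Col St.
  assert (Two : forall x y, x < y -> ~ fval M F x y 0 -> fval M F x y 1).
  { intros x y xy NF. destruct (Col x y xy) as (c & c2 & Hc & _). cbn in c2.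
    rewrite !lt_succ, add_0l in c2. destruct c2 as [[c2|c2]|c2].
    - now apply nlt0 in c2.
    - now rewrite c2 in Hc.
    - now rewrite c2 in Hc. }
  destruct (stable_homogeneous (fun x y => fval M F x y 0)) as (X & XU & HX).
  - unfold fval. d1.
  - intro x. destruct (St x) as (c & n & Hn). destruct (common_bound n x) as (m & nm & xm).
    assert (Hm : forall y, m < y -> x < y /\ fval M F x y c).
    { intros y my. assert (xy := lt_trans _ _ _ xm my). split; [easy|].
      apply Hn; [exact (lt_trans _ _ _ nm my)|easy]. }
    destruct (classic (c = 0)) as [->|D]; [left|right]; exists m; intros y my;
      destruct (Hm y my) as [xy Fc]; [easy|].
    intro F0. apply D. destruct (Col x y xy) as (c' & _ & _ & Un). now rewrite (Un c Fc), (Un 0 F0).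
  - exists X. split.
    + intro n. destruct (XU (n + 1)) as (x & nx & Hx). exists x. split; [now apply succ_le|easy].
    + destruct HX as [HX|HX]; [exists 0; easy|exists 1; auto].
Qed.

End Model.

Theorem theorem6p50 :
  forall (M : L2struct), RCA0 M ->
  forall E : S M, is_rado_graph M E -> RG2 M E 8 4 -> SRT22 M.
Proof. exact stable_ramsey. Qed.
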